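(* Let $k\ge1$ and $\epsilon\ge0$. Consider an $n$-player game with tree-form strategy sets $\mathcal X_1,\dots,\mathcal X_n$ and multilinear utilities $u_i$. For every $\epsilon$-linear-swap equilibrium $\pi\in\Delta(\mathcal X_1\times\dots\times\mathcal X_n)$ there exist tree-form decision problems $\mathcal Y_1,\dots,\mathcal Y_n$, $k$-mediator deviations $\phi_i\in\Phi^k_{\mathrm{med}}(\mathcal Y_i\to\mathcal X_i)$ with $\phi_i(\mathcal Y_i)\subseteq\mathcal X_i$, and a distribution $\pi'\in\Delta(\mathcal Y_1\times\dots\times\mathcal Y_n)$ such that $((\mathcal Y_i,\phi_i)_{i=1}^n,\pi')$ is a generalized $\epsilon$-$\Phi^k_{\mathrm{med}}$-equilibrium whose induced canonical profile is $\pi$.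
   Context: A tree-form decision problem is a finite rooted tree with decision points (player picks a child) and observation points (environment picks a child), alternating along root-to-leaf paths; pure strategies are represented by $\vec x\in\{0,1\}^{\mathcal Z}$ ($\mathcal Z$ = terminal nodes) with $\vec x[z]=1$ iff all actions on the root-to-$z$ path are played. The dual $\bar{\mathcal Y}$ swaps decision and observation points. The interleaving $\mathcal X\otimes\mathcal Y_1\otimes\dots\otimes\mathcal Y_k$ has as histories sequences of state tuples starting at the roots; a state is terminal iff all components are terminal; the environment moves every component at an observation point; otherwise the player chooses a non-terminal component and a child of it. A reduced strategy $\vec q$ assigns to each terminal state $(z,z_1,\dots,z_k)$ the total weight of (a mixed strategy on) terminal histories ending there. $\Phi^k_{\mathrm{med}}(\mathcal Y\to\mathcal X)$ is the set of maps $\phi_{\vec q}:\mathcal Y\to\mathrm{co}\,\mathcal X$, $\phi_{\vec q}(\vec y)[z]=\sum_{z_1,\dots,z_k}\vec q[z,z_1,\dots,z_k]\prod_{i=1}^k\vec y[z_i]$, $\vec q$ a reduced strategy of $\mathcal X\otimes\bar{\mathcal Y}^{\otimes k}$. A linear-swap deviation is a map $\mathcal X_i\to\mathrm{co}\,\mathcal X_i$ that is the restriction of a linear map; $\pi$ is an $\epsilon$-linear-swap equilibrium if no player gains more than $\epsilon$ by applying such a map to its sampled strategy: $\mathbb E_{\vec x\sim\pi}u_i(\psi(\vec x_i),\vec x_{-i})\le\mathbb E_{\vec x\sim\pi}u_i(\vec x)+\epsilon$. A generalized profile $((\mathcal Y_i,\phi_i)_i,\pi')$ is a generalized $\epsilon$-$\Phi^k_{\mathrm{med}}$-equilibrium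 if for every $i$ and every $\phi_i'\in\Phi^k_{\mathrm{med}}(\mathcal Y_i\to\mathcal X_i)$, $\mathbb E_{\vec y\sim\pi'}u_i(\phi_i'(\vec y_i),\phi_{-i}(\vec y_{-i}))\le\mathbb E_{\vec y\sim\pi'}u_i(\phi_i(\vec y_i),\phi_{-i}(\vec y_{-i}))+\epsilon$ (utilities extended multilinearly). When every $\phi_i$ maps $\mathcal Y_i$ into $\mathcal X_i$, its induced canonical profile is the distribution of $(\phi_1(\vec y_1),\dots,\phi_n(\vec y_n))$ for $\vec y\sim\pi'$. *)

(* Defs.v *)
From HB Require Import structures.
From mathcomp Require Import all_boot all_order all_algebra.
From mathcomp Require Import reals.
Unset Printing Implicit Defensive.
Import Order.TTheory GRing.Theory Num.Theory.
Local Open Scope ring_scope.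

(* Nodes are addressed by the sequence of child indices from the root. *)
Inductive gtree (L : Type) : Type :=
| Leaf of L
| Dec of seq (gtree L)
| Obs of seq (gtree L).
Arguments Leaf {L}. Arguments Dec {L}. Arguments Obs {L}.

Definition tree := gtree unit.

Definition children {L} (t : gtree L) : seq (gtree L) :=
  match t with Leaf _ => [::] | Dec cs => cs | Obs cs => cs end.
Definition is_leaf {L} (t : gtree L) : bool := if t is Leaf _ then true else false.
Definition is_dec {L} (t : gtree L) : bool := if t is Dec _ then true else false.
Definition is_obs {L} (t : gtree L) : bool := if t is Obs _ then true else false.

Fixpoint tree_form {L} (t : gtree L) : bool :=
  match t with
  | Leaf _ => true
  | Dec cs => (0 < size cs)%N && all (fun c => ~~ is_dec c) cs && all tree_form cs
  | Obs cs => (0 < size cs)%N && all (fun c => ~~ is_obs c) cs && all tree_form cs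
  end.

Fixpoint leaves {L} (t : gtree L) : seq (seq nat * L) :=
  let fix aux (i : nat) (cs : seq (gtree L)) : seq (seq nat * L) :=
      match cs with
      | [::] => [::]
      | c :: cs' => [seq (i :: p.1, p.2) | p <- leaves c] ++ aux i.+1 cs'
      end in
  match t with
  | Leaf l => [:: ([::], l)]
  | Dec cs => aux 0%N cs
  | Obs cs => aux 0%N cs
  end.

Definition Z {L} (t : gtree L) : finType := 'I_(size (leaves t)).
Definition addr {L} (t : gtree L) (z : Z t) : seq nat := (tnth (in_tuple (leaves t)) z).1.
Definition label {L} (t : gtree L) (z : Z t) : L := (tnth (in_tuple (leaves t)) z).2.

Fixpoint subtree {L} (p : seq nat) (t : gtree L) : option (gtree L) :=
  match p with
  | [::] => Some t
  | i :: p' => match onth (children t) i with Some c => subtree p' c | None => None end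
  end.

Definition valid_choice {L} (t : gtree L) (c : seq nat -> nat) : Prop :=
  forall p cs, subtree p t = Some (Dec cs) -> (c p < size cs)%N.

Definition plays {L} (t : gtree L) (c : seq nat -> nat) (a : seq nat) : bool :=
  all (fun j => if subtree (take j a) t is Some (Dec _)
                then c (take j a) == nth 0%N a j else true)
      (iota 0 (size a)).

Definition pure_vec {L} (t : gtree L) (c : seq nat -> nat) : {ffun Z t -> bool} :=
  [ffun z => plays t c (addr t z)].

Definition is_pure {L} (t : gtree L) (x : {ffun Z t -> bool}) : Prop :=
  exists c, valid_choice t c /\ x = pure_vec t c.

Definition vR {R : pzRingType} {L} (t : gtree L) (x : {ffun Z t -> bool}) : {ffun Z t -> R} :=
  [ffun z => (x z)%:R].

Definition in_co {R : realType} {L} (t : gtree L) (v : {ffun Z t -> R}) : Prop :=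
  exists lam : {ffun {ffun Z t -> bool} -> R},
    [/\ forall x, 0 <= lam x,
        forall x, lam x != 0 -> is_pure t x,
        \sum_x lam x = 1
      & forall z, v z = \sum_x lam x * (x z)%:R].

Fixpoint dual {L} (t : gtree L) : gtree L :=
  match t with
  | Leaf l => Leaf l
  | Dec cs => Obs (map dual cs)
  | Obs cs => Dec (map dual cs)
  end.

(* Interleaving of a tuple of trees.  A state is a tuple of nodes,     *)
(* each given as (current subtree, its address in its component).     *)
(* The nodes of the interleaved tree are histories of states; leaves   *)
(* are labelled by the terminal state (tuple of component addresses). *)
Fixpoint cprod {A} (ls : seq (seq A)) : seq (seq A) :=
  match ls with
  | [::] => [:: [::]]
  | l :: ls' => [seq x :: r | x <- l, r <- cprod ls']
  end.

Definition kids (s : tree * seq nat) : seq (tree * seq nat) :=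
  [seq (nth (Leaf tt) (children s.1) i, rcons s.2 i) | i <- iota 0 (size (children s.1))].

Definition st0 : tree * seq nat := (Leaf tt, [::]).

Fixpoint itl (fuel : nat) (st : seq (tree * seq nat)) : gtree (seq (seq nat)) :=
  match fuel with
  | 0%N => Leaf (map snd st)
  | f.+1 =>
    if all (fun s => is_leaf s.1) st then Leaf (map snd st)
    else if has (fun s => is_obs s.1) st then
      (* environment moves every component at an observation point *)
      Obs [seq itl f st' | st' <- cprod [seq (if is_obs s.1 then kids s else [:: s]) | s <- st]]
    else
      (* player picks a non-terminal component j and a child of it *)
      Dec (flatten [seq [seq itl f (set_nth st0 st j s') | s' <- kids (nth st0 st j)]
                   | j <- iota 0 (size st)])
  end.

Fixpoint tsize {L} (t : gtree L) : nat :=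
  match t with
  | Leaf _ => 1%N
  | Dec cs => (sumn (map tsize cs)).+1
  | Obs cs => (sumn (map tsize cs)).+1
  end.

(* X (x) Ybar^(x)k ; the fuel (total size + 1) is always sufficient. *)
Definition interleave (tX tY : tree) (k : nat) : gtree (seq (seq nat)) :=
  let comps := tX :: nseq k (dual tY) in
  itl (sumn (map tsize comps)).+1 [seq (t, [::]) | t <- comps].

(* Terminal states (z, z_1, ..., z_k) of X (x) Ybar^(x)k. *)
Definition TS (tX tY : tree) (k : nat) : finType := (Z tX * {ffun 'I_k -> Z tY})%type.

Definition reduced {R : realType} (tX tY : tree) (k : nat) (q : {ffun TS tX tY k -> R}) : Prop :=
  exists x : {ffun Z (interleave tX tY k) -> R},
    in_co (interleave tX tY k) x /\
    forall zz : TS tX tY k,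
      q zz = \sum_(l : Z (interleave tX tY k)
                   | label (interleave tX tY k) l
                       == addr tX zz.1 :: [seq addr tY (zz.2 i) | i <- enum 'I_k])
               x l.

Definition med {R : realType} (tX tY : tree) (k : nat) (q : {ffun TS tX tY k -> R})
  (y : {ffun Z tY -> R}) : {ffun Z tX -> R} :=
  [ffun z => \sum_(zs : {ffun 'I_k -> Z tY}) q (z, zs) * \prod_(i < k) y (zs i)].

Definition PZ (n : nat) (T : 'I_n -> tree) : finType := {dffun forall j : 'I_n, Z (T j)}.
Definition PX (n : nat) (T : 'I_n -> tree) : finType :=
  {dffun forall j : 'I_n, {ffun Z (T j) -> bool}}.

Definition util {R : realType} (n : nat) (T : 'I_n -> tree) (U : PZ n T -> R)
  (v : forall j, {ffun Z (T j) -> R}) : R :=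
  \sum_(z : PZ n T) U z * \prod_(j < n) v j (z j).

Definition util_dev {R : realType} (n : nat) (T : 'I_n -> tree) (U : PZ n T -> R)
  (v : forall j, {ffun Z (T j) -> R}) (i : 'I_n) (w : {ffun Z (T i) -> R}) : R :=
  \sum_(z : PZ n T) U z * (w (z i) * \prod_(j < n | j != i) v j (z j)).

Definition is_dist {R : realType} (n : nat) (T : 'I_n -> tree) (pi : PX n T -> R) : Prop :=
  [/\ forall x, 0 <= pi x, \sum_x pi x = 1
    & forall x, pi x != 0 -> forall j, is_pure (T j) (x j)].

Definition linmap {R : realType} (t : tree) (A : Z t -> Z t -> R) (v : {ffun Z t -> R})
  : {ffun Z t -> R} := [ffun z => \sum_z' A z z' * v z'].

Definition lin_swap {R : realType} (t : tree) (A : Z t -> Z t -> R) : Prop :=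
  forall x, is_pure t x -> in_co t (linmap t A (vR t x)).

Definition lin_swap_eq {R : realType} (n : nat) (T : 'I_n -> tree) (U : 'I_n -> PZ n T -> R)
  (eps : R) (pi : PX n T -> R) : Prop :=
  forall (i : 'I_n) (A : Z (T i) -> Z (T i) -> R), lin_swap (T i) A ->
    \sum_x pi x * util_dev n T (U i) (fun j => vR (T j) (x j)) i (linmap (T i) A (vR (T i) (x i)))
    <= \sum_x pi x * util n T (U i) (fun j => vR (T j) (x j)) + eps.

Definition gen_eq {R : realType} (n k : nat) (T : 'I_n -> tree) (U : 'I_n -> PZ n T -> R)
  (eps : R) (S : 'I_n -> tree) (q : forall i, {ffun TS (T i) (S i) k -> R})
  (pi' : PX n S -> R) : Prop :=
  forall (i : 'I_n) (q' : {ffun TS (T i) (S i) k -> R}), reduced (T i) (S i) k q' ->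
    \sum_y pi' y * util_dev n T (U i) (fun j => med (T j) (S j) k (q j) (vR (S j) (y j)))
                     i (med (T i) (S i) k q' (vR (S i) (y i)))
    <= \sum_y pi' y * util n T (U i) (fun j => med (T j) (S j) k (q j) (vR (S j) (y j))) + eps.

(* Main.v *)
(* Every player's strategy x is hidden by a one-time pad.  A pure strategy of the decision problem Y
   consists of k - 1 shares, whose sum is a uniform pad, together with a "relay": a tree that is told
   the observations made in X and answers each time with the action of x shifted by the pad.  Querying
   all the shares and then running the relay with the last mediator, the honest player decrypts x
   online.  For a deviation, the k queried leaves of Y either miss a share, in which case they are
   jointly independent of x, or contain at most one relay leaf, which given the shares reveals only
   whether x plays one path of X.  Hence all k-fold moments are linear in x, so a k-mediator deviation
   acts on average as a linear map into co X.  That mediator deviations land in co X is shown by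
   simulating a pure strategy of the interleaving against a pure strategy of Y. *)

(* boolp precedes Defs because it exports another gen_eq. *)
From mathcomp Require Import boolp.
Require Import Defs.
From HB Require Import structures.
From mathcomp Require Import all_boot all_order all_algebra.
From mathcomp Require Import reals.
Import Order.TTheory GRing.Theory Num.Theory.
Local Open Scope ring_scope.

(** A mediator returns a single terminal node of [Y], so a ciphertext can never be read as a whole;
    the relay is interactive because it has to be queried while [X] is being played. A strategy
    becomes a table with one symbol per sequence of observations, since observations and strategy
    together determine the node reached; the pad is a table of the same shape over the cyclic group
    of order [D.+1]. [D] bounds the size of every player's tree, hence all arities and depths, so
    one [Y] serves all players. The number of shares comes from a pigeonhole count: learning more
    than one path of [x] takes two relay queries, which leaves one query too few for the shares.
    With one mediator there are no shares and the table is sent in clear, which is harmless because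
    a single path is all that can be asked. That one path of [X] is linear information, even if it
    ends at an inner node, comes from flow conservation of pure strategies. *)

Notation nth_tree := (nth (Obs [::])).

(** * Trees, their nodes and their leaves *)

Lemma tsize_gt0 L (t : gtree L) : (0 < Defs.tsize t)%N.
Proof. by case: t. Qed.

Lemma ltn_tsize_child L (t : gtree L) i : (i < size (children t))%N ->
  (Defs.tsize (nth_tree (children t) i) < Defs.tsize t)%N.
Proof.
have H (cs : seq (gtree L)) : (i < size cs)%N ->
    (Defs.tsize (nth_tree cs i) < (sumn (map Defs.tsize cs)).+1)%N.
  rewrite ltnS; elim: cs i => [|c cs IH] [|i] //= Hi; first exact: leq_addr.
  exact: leq_trans (IH _ Hi) (leq_addl _ _).
by case: t => //= cs; exact: H.
Qed.

(** The generated principle for this nested type gives no hypothesis on the elements of a child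
    list, so the induction runs on [tsize]; children are taken by index because addresses are index
    sequences. *)
Lemma gtree_nth_ind L (P : gtree L -> Prop) :
  (forall l, P (Leaf l)) ->
  (forall cs, (forall i, (i < size cs)%N -> P (nth_tree cs i)) -> P (Dec cs)) ->
  (forall cs, (forall i, (i < size cs)%N -> P (nth_tree cs i)) -> P (Obs cs)) ->
  forall t, P t.
Proof.
move=> HL HD HO t; have [m] := ubnP (Defs.tsize t); elim: m t => // m IH t Ht.
have {IH}Hc i : (i < size (children t))%N -> P (nth_tree (children t) i).
  by move=> Hi; apply: IH; apply: leq_trans (ltn_tsize_child _ _ _ Hi) Ht.
by case: t Ht Hc => [l|cs|cs] _ Hc; [exact: HL | exact: HD | exact: HO].
Qed.

(** Interleavings do not alternate, so [tree_form] is lost; non-empty child lists survive and are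
    what the existence of choices and of played leaves rests on. *)
Fixpoint inhabited_tree {L} (t : gtree L) : bool :=
  match t with
  | Leaf _ => true
  | Dec cs => (0 < size cs)%N && all inhabited_tree cs
  | Obs cs => (0 < size cs)%N && all inhabited_tree cs
  end.

Lemma tree_form_inhabited L (t : gtree L) : tree_form t -> inhabited_tree t.
Proof.
elim/gtree_nth_ind: t => [//|cs IH|cs IH] /= /andP[/andP[-> _]] /(all_nthP (Obs [::])) H;
by apply/(all_nthP (Obs [::])) => i Hi; apply: IH => //; exact: H.
Qed.

Lemma inhabited_dual L (t : gtree L) : inhabited_tree t -> inhabited_tree (dual t).
Proof.
elim/gtree_nth_ind: t => [//|cs IH|cs IH] /= /andP[Hs] /(all_nthP (Obs [::])) H;
rewrite size_map Hs all_map /=; apply/(all_nthP (Obs [::])) => i Hi /=;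
by apply: IH => //; exact: H.
Qed.

Lemma inhabited_child L (t : gtree L) i :
  inhabited_tree t -> (i < size (children t))%N ->
  inhabited_tree (nth_tree (children t) i).
Proof. by case: t => //= cs /andP[_] /(all_nthP (Obs [::])) H /H. Qed.

Lemma tree_form_child L (t : gtree L) i :
  tree_form t -> (i < size (children t))%N ->
  tree_form (nth_tree (children t) i).
Proof. by case: t => //= cs /andP[_] /(all_nthP (Obs [::])) H /H. Qed.

Lemma tree_form_obs_child L (cs : seq (gtree L)) i :
  tree_form (Obs cs) -> (i < size cs)%N -> ~~ is_obs (nth_tree cs i).
Proof. by move=> /= /andP[/andP[_ /(all_nthP (Obs [::])) H] _] /H. Qed.

Lemma size_children_tsize L (t : gtree L) : (size (children t) < Defs.tsize t)%N.
Proof.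
have H (cs : seq (gtree L)) : (size cs <= sumn (map Defs.tsize cs))%N.
  by elim: cs => //= c cs IH; rewrite -add1n leq_add ?tsize_gt0.
by case: t => //= cs; rewrite ltnS.
Qed.

Lemma dualK L (t : gtree L) : dual (dual t) = t.
Proof.
elim/gtree_nth_ind: t => [//|cs IH|cs IH] /=; congr (_ _); rewrite -map_comp;
apply: (@eq_from_nth _ (Obs [::])); rewrite ?size_map // => i Hi;
by rewrite !(nth_map (Obs [::])) //=; exact: IH.
Qed.

Lemma children_dual L (t : gtree L) : children (dual t) = map dual (children t).
Proof. by case: t. Qed.

Lemma subtree_dual L p (t : gtree L) : subtree p (dual t) = omap dual (subtree p t).
Proof.
elim: p t => [//|i p IH] t /=; rewrite children_dual onth_map.
by case: (onth (children t) i) => //=.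
Qed.

Lemma subtree_cons L i p (t : gtree L) : (i < size (children t))%N ->
  subtree (i :: p) t = subtree p (nth_tree (children t) i).
Proof.
move=> Hi /=; have := onthTE (children t) i; rewrite Hi.
by case E: (onth _ _) => [c|//] _; rewrite (onth_nth (Obs [::]) _ _ _ E).
Qed.

Lemma subtree_cat L p q (t : gtree L) :
  subtree (p ++ q) t = obind (subtree q) (subtree p t).
Proof. by elim: p t => [//|i p IH] t /=; case: (onth _ _). Qed.

Lemma subtree_rcons L p i (t u : gtree L) : subtree p t = Some u ->
  (i < size (children u))%N -> subtree (rcons p i) t = Some (nth_tree (children u) i).
Proof. by move=> H Hi; rewrite -cats1 subtree_cat H /= -[RHS]/(subtree [::] _) -subtree_cons. Qed.

Lemma inhabited_subtree L p (t u : gtree L) :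
  inhabited_tree t -> subtree p t = Some u -> inhabited_tree u.
Proof.
elim: p t => [|i p IH] t Ht /=; first by case=> <-.
case E: (onth _ _) => [c|//]; apply: IH.
by have := onthTE (children t) i; rewrite E => Hi;
  rewrite -(onth_nth (Obs [::]) _ _ _ E); apply: inhabited_child.
Qed.

Lemma flatten_map_iota A (F : nat -> seq A) (G : nat -> seq A) n m :
  (forall i, (i < n)%N -> F (m + i)%N = G i) ->
  flatten (map F (iota m n)) = flatten (map G (iota 0 n)).
Proof.
by move=> H; rewrite -[m]addn0 iotaDl -map_comp; congr flatten;
  apply/eq_in_map => i; rewrite mem_iota add0n => /andP[_ Hi]; exact: H.
Qed.

Lemma leaves_node L (t : gtree L) : ~~ is_leaf t ->
  leaves t = flatten [seq [seq (i :: p.1, p.2) | p <- leaves (nth_tree (children t) i)]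
                     | i <- iota 0 (size (children t))].
Proof.
pose aux := fix aux (i : nat) (cs : seq (gtree L)) : seq (seq nat * L) :=
      match cs with
      | [::] => [::]
      | c :: cs' => [seq (i :: p.1, p.2) | p <- leaves c] ++ aux i.+1 cs'
      end.
have H cs m : aux m cs = flatten [seq [seq ((m + i)%N :: p.1, p.2) | p <- leaves (nth_tree cs i)]
                     | i <- iota 0 (size cs)].
  elim: cs m => [//|c cs IH] m /=; rewrite addn0; congr (_ ++ _).
  rewrite IH; symmetry; apply: flatten_map_iota => i _.
  by rewrite /= add1n addnS addSn.
by case: t => // cs _ /=; rewrite -/aux H.
Qed.

Lemma mem_leaves_node (L : eqType) (t : gtree L) i p l : (i < size (children t))%N ->
  ((i :: p, l) \in leaves t) = ((p, l) \in leaves (nth_tree (children t) i)).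
Proof.
move=> Hi; have Ht : ~~ is_leaf t by case: t Hi.
rewrite leaves_node //; apply/flatten_mapP/idP.
- case=> j; rewrite mem_iota add0n => /andP[_ Hj] /mapP[[q l'] Hq /= [-> -> ->]].
  exact: Hq.
- move=> H; exists i; first by rewrite mem_iota.
  by apply/mapP; exists (p, l).
Qed.

Lemma leaves_nodeP (L : eqType) (t : gtree L) x : ~~ is_leaf t -> x \in leaves t ->
  exists i p, [/\ (i < size (children t))%N, x.1 = i :: p
                & (p, x.2) \in leaves (nth_tree (children t) i)].
Proof.
move=> Ht; rewrite leaves_node // => /flatten_mapP[i]; rewrite mem_iota add0n => /andP[_ Hi].
by case/mapP=> -[p l] Hp ->; exists i, p.
Qed.

Lemma sum_leaves_node {R : nmodType} L (t : gtree L) (F : seq nat * L -> R) : ~~ is_leaf t ->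
  \sum_(x <- leaves t) F x =
  \sum_(i < size (children t)) \sum_(x <- leaves (nth_tree (children t) i)) F (val i :: x.1, x.2).
Proof.
move=> Ht; rewrite leaves_node // big_flatten big_map.
have -> : iota 0 (size (children t)) = index_iota 0 (size (children t)).
  by rewrite /index_iota subn0.
rewrite big_mkord.
by apply: eq_bigr => i _; rewrite big_map.
Qed.

Lemma uniq_leaves (L : eqType) (t : gtree L) : uniq (map fst (leaves t)).
Proof.
have key (u : gtree L) : ~~ is_leaf u ->
    (forall i, (i < size (children u))%N -> uniq (map fst (leaves (nth_tree (children u) i)))) ->
    uniq (map fst (leaves u)).
  move=> Hu IH; rewrite leaves_node // map_flatten -map_comp.
  have : forall i, i \in iota 0 (size (children u)) -> (i < size (children u))%N.
    by move=> i; rewrite mem_iota.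
  elim: (iota _ _) (iota_uniq 0 (size (children u))) => [//|i s IHs] /= /andP[Hi Hs] Hb.
  rewrite cat_uniq IHs // ?andbT; last by move=> j Hj; apply: Hb; rewrite inE Hj orbT.
  rewrite -map_comp (map_comp (cons i) fst) map_inj_uniq; last by move=> ? ? [].
  rewrite IH ?Hb ?mem_head //=; apply/hasPn => x /flatten_mapP[j Hj].
  case/mapP => y0 /mapP[y _ ->] -> /=; apply/negP => /mapP[y' _ [ji _]].
  by rewrite -ji Hj in Hi.
elim/gtree_nth_ind: t => [//|cs IH|cs IH]; exact: key.
Qed.

(** The ordinal type [Z t] does not decompose along children; the list of leaves does, and
    inductions run there. *)
Lemma sum_Z {R : nmodType} L (t : gtree L) (F : seq nat * L -> R) :
  \sum_(z : Z t) F (addr t z, label t z) = \sum_(x <- leaves t) F x.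
Proof.
by rewrite [RHS]big_tnth; apply: eq_bigr => i _; rewrite /addr /label; case: (tnth _ _).
Qed.

Lemma addr_leaves (L : eqType) (t : gtree L) (z : Z t) : (addr t z, label t z) \in leaves t.
Proof. by rewrite /addr /label -surjective_pairing; exact: mem_tnth. Qed.

Lemma leaves_addr (L : eqType) (t : gtree L) x : x \in leaves t ->
  exists z : Z t, addr t z = x.1 /\ label t z = x.2.
Proof. by move=> /(tnthP (in_tuple _)) [z ->]; exists z. Qed.

Lemma addr_inj (L : eqType) (t : gtree L) : injective (@addr L t).
Proof.
have U := uniq_leaves L t => z z'; have x0 : seq nat * L := tnth (in_tuple (leaves t)) z.
rewrite /addr !(tnth_nth x0) /= -!(nth_map x0 x0.1) // => H.
by apply/val_inj/eqP; rewrite -(nth_uniq x0.1 _ _ U) ?size_map ?ltn_ord // H.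
Qed.

Lemma subtree_leaf (L : eqType) p (t : gtree L) l : subtree p t = Some (Leaf l) ->
  (p, l) \in leaves t.
Proof.
elim: p t => [|i p IH] t; first by case=> ->; rewrite inE.
case Hi : (i < size (children t))%N.
  by rewrite subtree_cons // => /IH; rewrite mem_leaves_node.
by rewrite /= onth_default // leqNgt Hi.
Qed.

(** * Pure strategies along paths *)

Lemma plays_nil L (t : gtree L) c : plays t c [::] = true.
Proof. by []. Qed.

Lemma plays_rcons L (t : gtree L) c a i :
  plays t c (rcons a i) =
  plays t c a && (if subtree a t is Some (Dec _) then c a == i else true).
Proof.
rewrite /plays size_rcons -addn1 iotaD all_cat /= andbT add0n; congr (_ && _).
- apply: eq_in_all => j; rewrite mem_iota add0n => /andP[_ Hj].
  by rewrite -cats1 takel_cat ?nth_cat ?Hj // ltnW.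
- by rewrite -cats1 takel_cat // take_size nth_cat ltnn subnn.
Qed.

Lemma plays_cat L (t : gtree L) c a b : plays t c (a ++ b) -> plays t c a.
Proof.
by elim/last_ind: b => [|b i IH]; rewrite ?cats0 // -rcons_cat plays_rcons => /andP[/IH].
Qed.

Lemma plays_cons L (t : gtree L) c i a : (i < size (children t))%N ->
  plays t c (i :: a) =
  (if t is Dec _ then c [::] == i else true)
  && plays (nth_tree (children t) i) (fun r => c (i :: r)) a.
Proof.
move=> Hi; elim/last_ind: a => [|a j IH].
  by rewrite -[[:: i]]/(rcons [::] i) plays_rcons !plays_nil andbT.
by rewrite -rcons_cons plays_rcons IH plays_rcons subtree_cons // andbA.
Qed.

Lemma plays_ext L (t : gtree L) c c' a : c =1 c' -> plays t c a = plays t c' a.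
Proof. by move=> H; apply: eq_all => j; rewrite H. Qed.

Lemma valid_choice_child L (t : gtree L) c i : (i < size (children t))%N ->
  valid_choice t c -> valid_choice (nth_tree (children t) i) (fun r => c (i :: r)).
Proof. by move=> Hi H p cs Hp; apply: (H (i :: p)); rewrite subtree_cons. Qed.

Lemma valid_choice_dec L cs (c : seq nat -> nat) :
  valid_choice (Dec cs : gtree L) c -> (c [::] < size cs)%N.
Proof. by move=> H; exact: H. Qed.

Lemma valid_choice_node L (t : gtree L) c : (is_dec t -> (c [::] < size (children t))%N) ->
  (forall i, (i < size (children t))%N ->
     valid_choice (nth_tree (children t) i) (fun r => c (i :: r))) -> valid_choice t c.
Proof.
move=> H0 H [|i p] cs; first by case=> E; move: H0; rewrite E; apply.
case Hi : (i < size (children t))%N; last by rewrite /= onth_default // leqNgt Hi.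
by rewrite subtree_cons // => /(H _ Hi).
Qed.

Lemma valid_choice0 L (t : gtree L) : inhabited_tree t -> valid_choice t (fun=> 0%N).
Proof.
elim/gtree_nth_ind: t => [l|cs IH|cs IH] Ht.
- by move=> [|[|i] p] cs.
- apply: valid_choice_node => [_|i Hi]; first by case/andP: Ht.
  exact: IH Hi (inhabited_child _ _ _ Ht Hi).
- apply: valid_choice_node => [//|i Hi].
  exact: IH Hi (inhabited_child _ _ _ Ht Hi).
Qed.

Lemma exists_played_leaf (L : eqType) (t : gtree L) c : inhabited_tree t -> valid_choice t c ->
  exists2 x, x \in leaves t & plays t c x.1.
Proof.
elim/gtree_nth_ind: t c => [l|cs IH|cs IH] c Ht Hc.
- by exists ([::], l); rewrite ?inE.
- have Hi := valid_choice_dec _ _ _ Hc.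
  have [[p l] Hp Hpl] := IH _ Hi _ (inhabited_child _ (Dec cs) _ Ht Hi) (valid_choice_child _ (Dec cs) _ _ Hi Hc).
  by exists (c [::] :: p, l); rewrite ?mem_leaves_node //= plays_cons //= eqxx.
- have Hi : (0 < size cs)%N by case/andP: Ht.
  have [[p l] Hp Hpl] := IH _ Hi _ (inhabited_child _ (Obs cs) _ Ht Hi) (valid_choice_child _ (Obs cs) _ _ Hi Hc).
  by exists (0%N :: p, l); rewrite ?mem_leaves_node //= plays_cons.
Qed.

(** Below its own choice at a decision point [c] plays some leaf, and inclusion forces [c'] to take
    the same child. Supports of pure strategies are therefore never strictly nested. *)
Lemma plays_antichain (L : eqType) (t : gtree L) c c' : inhabited_tree t ->
  valid_choice t c -> valid_choice t c' ->
  (forall x, x \in leaves t -> plays t c x.1 -> plays t c' x.1) ->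
  forall x, x \in leaves t -> plays t c' x.1 -> plays t c x.1.
Proof.
elim/gtree_nth_ind: t c c' => [l|cs IH|cs IH] c c' Ht Hc Hc' H x Hx.
- by move: Hx; rewrite inE => /eqP ->.
- case/leaves_nodeP: Hx => // i [p [Hi -> Hp]]; rewrite !plays_cons //= => /andP[/eqP c'i pl'].
  have Hj := valid_choice_dec _ _ _ Hc.
  have [[q l] Hq plq] := exists_played_leaf _ _ _ (inhabited_child _ (Dec cs) _ Ht Hj)
                       (valid_choice_child _ (Dec cs) _ _ Hj Hc).
  have := H (c [::] :: q, l); rewrite mem_leaves_node //= !plays_cons //= eqxx /=.
  move=> /(_ Hq plq) /andP[/eqP E _]; have ci : c [::] = i by rewrite -E.
  rewrite ci eqxx /=.
  apply: (IH i Hi _ (fun r => c' (i :: r)) (inhabited_child _ (Dec cs) _ Ht Hi) (valid_choice_child _ (Dec cs) _ _ Hi Hc)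
            (valid_choice_child _ (Dec cs) _ _ Hi Hc') _ (p, x.2)) => // -[r l'] Hr plr.
  have := H (i :: r, l'); rewrite mem_leaves_node //= !plays_cons //= ci c'i eqxx /=.
  exact.
- case/leaves_nodeP: Hx => // i [p [Hi -> Hp]]; rewrite !plays_cons //=.
  apply: (IH i Hi _ (fun r => c' (i :: r)) (inhabited_child _ (Obs cs) _ Ht Hi) (valid_choice_child _ (Obs cs) _ _ Hi Hc)
            (valid_choice_child _ (Obs cs) _ _ Hi Hc') _ (p, x.2)) => // -[r l'] Hr plr.
  by have := H (i :: r, l'); rewrite mem_leaves_node //= !plays_cons //=; exact.
Qed.

HB.instance Definition _ (L : Type) := gen_eqMixin (gtree L).

(** * Interleavings *)

Definition state_size (st : seq (tree * seq nat)) : nat :=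
  sumn [seq Defs.tsize s.1 | s <- st].

Definition obs_succ (st : seq (tree * seq nat)) :=
  cprod [seq (if is_obs s.1 then kids s else [:: s]) | s <- st].

Definition dec_succ (st : seq (tree * seq nat)) :=
  flatten [seq [seq set_nth st0 st j s' | s' <- kids (nth st0 st j)] | j <- iota 0 (size st)].

Lemma itl_leaf f st : all (fun s => is_leaf s.1) st -> itl f st = Leaf (map snd st).
Proof. by case: f => //= f ->. Qed.

Lemma itl_obs f st : has (fun s => is_obs s.1) st ->
  itl f.+1 st = Obs (map (itl f) (obs_succ st)).
Proof.
move=> H /=; rewrite H ifF //; apply/negbTE; rewrite -has_predC.
by apply: sub_has H => -[[]].
Qed.

Lemma itl_dec f st : ~~ all (fun s => is_leaf s.1) st -> ~~ has (fun s => is_obs s.1) st ->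
  itl f.+1 st = Dec (map (itl f) (dec_succ st)).
Proof.
move=> /negbTE H1 /negbTE H2 /=; rewrite H1 H2 /dec_succ map_flatten -map_comp.
by congr (Dec (flatten _)); apply: eq_map => j /=; rewrite -map_comp.
Qed.

Lemma kidsP s s' : s' \in kids s ->
  exists2 i, (i < size (children s.1))%N & s' = (nth_tree (children s.1) i, rcons s.2 i).
Proof.
case/mapP => i; rewrite mem_iota add0n => /andP[_ Hi] ->; exists i => //.
by rewrite (set_nth_default (Obs [::])).
Qed.

Lemma mem_kids s i : (i < size (children s.1))%N ->
  (nth_tree (children s.1) i, rcons s.2 i) \in kids s.
Proof.
move=> Hi; apply/mapP; exists i; first by rewrite mem_iota.
by rewrite (set_nth_default (Leaf tt)).
Qed.

Lemma mem_cprod (A : eqType) (ls : seq (seq A)) st :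
  (st \in cprod ls) = all2 (fun x l => x \in l) st ls.
Proof.
elim: ls st => [|l ls IH] [|x st] //=; first by apply/allpairsP => -[[? ?]] [].
apply/allpairsP/andP => [[[y r] /= [Hy Hr [-> ->]]]|[Hx Hst]]; first by rewrite -IH.
by exists (x, st); rewrite IH.
Qed.

Lemma mem_obs_succ st st' : st' \in obs_succ st <->
  size st' = size st /\ forall j, (j < size st)%N ->
    nth st0 st' j \in (if is_obs (nth st0 st j).1 then kids (nth st0 st j) else [:: nth st0 st j]).
Proof.
rewrite /obs_succ mem_cprod; elim: st st' => [|s st IH] [|s' st'] //=.
- by split=> // -[].
- by split=> // -[].
- split=> [/andP[H /IH [-> H']]|[[Hs] H]].
    by split=> // j; case: j => [_|j Hj]; [exact: H | exact: H'].
  by rewrite (H 0%N) //=; apply/IH; split=> // j Hj; exact: (H j.+1).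
Qed.

Lemma mem_dec_succ st st' : st' \in dec_succ st <->
  exists j s', [/\ (j < size st)%N, s' \in kids (nth st0 st j) & st' = set_nth st0 st j s'].
Proof.
split=> [/flatten_mapP[j]|[j [s' [Hj Hs' ->]]]].
  rewrite mem_iota add0n => /andP[_ Hj] /mapP[s' Hs' ->].
  by exists j, s'.
by apply/flatten_mapP; exists j; rewrite ?mem_iota //; apply/mapP; exists s'.
Qed.

Lemma size_dec_succ st st' : st' \in dec_succ st -> size st' = size st.
Proof.
case/mem_dec_succ => j [s' [Hj _ ->]]; rewrite size_set_nth; exact/maxn_idPr.
Qed.

Lemma kids_size s s' : s' \in kids s -> (Defs.tsize s'.1 < Defs.tsize s.1)%N.
Proof. by case/kidsP => i Hi -> /=; exact: ltn_tsize_child. Qed.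

Lemma kids_prefix s s' : s' \in kids s -> prefix s.2 s'.2.
Proof. by case/kidsP => i Hi -> /=; exact: prefix_rcons. Qed.

Lemma kids_subtree t s s' : subtree s.2 t = Some s.1 -> s' \in kids s ->
  subtree s'.2 t = Some s'.1.
Proof. by move=> H /kidsP[i Hi ->] /=; exact: subtree_rcons. Qed.

Lemma state_size_obs_succ st st' : has (fun s => is_obs s.1) st -> st' \in obs_succ st ->
  (state_size st' < state_size st)%N.
Proof.
have W st1 st2 : st2 \in obs_succ st1 -> (state_size st2 <= state_size st1)%N.
  rewrite /obs_succ mem_cprod.
  elim: st1 st2 => [|s st1 IH] [|s' st2] //= /andP[Hs /IH H].
  apply: leq_add H; move: Hs; case: (is_obs s.1) => [/kids_size /ltnW //|].
  by rewrite inE => /eqP ->.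
rewrite /obs_succ mem_cprod; elim: st st' => [|s st IH] [|s' st'] //= H /andP[Hs Hst].
have L := W st st'; rewrite /obs_succ mem_cprod in L; have {}L := L Hst.
rewrite /state_size /=; case E : (is_obs s.1) H Hs => /= H.
  by move=> /kids_size Hs; rewrite -addSn leq_add.
by rewrite inE => /eqP ->; rewrite ltn_add2l; exact: IH.
Qed.

Lemma state_size_set st j s' : (j < size st)%N ->
  (Defs.tsize s'.1 < Defs.tsize (nth st0 st j).1)%N ->
  (state_size (set_nth st0 st j s') < state_size st)%N.
Proof.
rewrite /state_size; elim: st j => [//|s st IH] [|j] /= Hj H; first by rewrite ltn_add2r.
by rewrite ltn_add2l; exact: IH.
Qed.

Lemma state_size_dec_succ st st' : st' \in dec_succ st -> (state_size st' < state_size st)%N.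
Proof.
case/mem_dec_succ => j [s' [Hj Hs' ->]]; apply: state_size_set => //; exact: kids_size.
Qed.

(** Component addresses only grow along a history; a subtree can be discarded as soon as one
    component has left the intended path. *)
Lemma leaves_itl_prefix f st x : x \in leaves (itl f st) ->
  size x.2 = size st /\
  forall j, (j < size st)%N -> prefix (nth st0 st j).2 (nth [::] x.2 j).
Proof.
elim: f st x => [|f IH] st x.
  rewrite /= inE => /eqP -> /=; rewrite size_map; split=> // j Hj.
  by rewrite (nth_map st0) // prefix_refl.
case: (boolP (all (fun s => is_leaf s.1) st)) => [Hl|Hl].
  rewrite itl_leaf // inE => /eqP -> /=; rewrite size_map; split=> // j Hj.
  by rewrite (nth_map st0) // prefix_refl.
case: (boolP (has (fun s => is_obs s.1) st)) => [Ho|Ho].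
  rewrite itl_obs // => /leaves_nodeP [//|i [p]] /=; rewrite size_map => -[Hi _].
  rewrite (nth_map [::]) // => /IH /= [Hs Hp].
  have /mem_obs_succ[Hs' Hn] := mem_nth [::] Hi; rewrite Hs Hs'; split=> // j Hj.
  rewrite Hs' in Hp; apply: prefix_trans (Hp _ Hj).
  have := Hn _ Hj; case: (is_obs _) => [/kids_prefix //|].
  by rewrite inE => /eqP ->; exact: prefix_refl.
rewrite itl_dec // => /leaves_nodeP [//|i [p]] /=; rewrite size_map => -[Hi _].
rewrite (nth_map [::]) // => /IH /= [Hs Hp].
have Hm := mem_nth [::] Hi; have Hs' := size_dec_succ _ _ Hm.
rewrite Hs Hs'; split=> // j Hj; rewrite Hs' in Hp; apply: prefix_trans (Hp _ Hj).
case/mem_dec_succ: Hm => j' [s' [Hj' Hk ->]]; rewrite nth_set_nth /=.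
by case: eqP => [->|_]; [exact: kids_prefix | exact: prefix_refl].
Qed.

Lemma inhabited_kids s s' : inhabited_tree s.1 -> s' \in kids s -> inhabited_tree s'.1.
Proof. by move=> H /kidsP[i Hi ->] /=; exact: inhabited_child. Qed.

Lemma kids_inhabited s : inhabited_tree s.1 -> ~~ is_leaf s.1 -> (0 < size (kids s))%N.
Proof. by case: s => -[//|cs|cs] p /andP[H _] _; rewrite /= size_map size_iota. Qed.

Lemma all_nth_state (P : pred (tree * seq nat)) st :
  all P st <-> forall j, (j < size st)%N -> P (nth st0 st j).
Proof. by split=> [/(all_nthP st0)|H]; [|apply/(all_nthP st0)]. Qed.

Lemma size_cprod A (ls : seq (seq A)) :
  all (fun l => 0 < size l)%N ls -> (0 < size (cprod ls))%N.
Proof.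
by elim: ls => [//|l ls IH] /= /andP[H1 /IH H2]; rewrite size_allpairs muln_gt0 H1 H2.
Qed.

Lemma inhabited_itl f st : all (fun s => inhabited_tree s.1) st -> inhabited_tree (itl f st).
Proof.
elim: f st => [//|f IH] st Hne.
case: (boolP (all (fun s => is_leaf s.1) st)) => [Hl|Hl]; first by rewrite itl_leaf.
case: (boolP (has (fun s => is_obs s.1) st)) => [Ho|Ho].
  rewrite itl_obs //= size_map; apply/andP; split.
    apply: size_cprod; rewrite all_map; apply: sub_all Hne => s Hs /=.
    by case E : (is_obs s.1) => //; apply: kids_inhabited => //; case: (s.1) E.
  rewrite all_map; apply/allP => st' /mem_obs_succ[Hs' Hn] /=; apply: IH.
  apply/all_nth_state => j; rewrite Hs' => Hj; move/all_nth_state: Hne => /(_ j Hj) Hne.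
  have := Hn j Hj; case: (is_obs _); first exact: inhabited_kids.
  by rewrite inE => /eqP ->.
rewrite itl_dec //= size_map; apply/andP; split.
  move: Hl; rewrite -has_predC => /(has_nthP st0) [j Hj /= Hjl].
  have := kids_inhabited (nth st0 st j); move/all_nth_state: Hne => /(_ j Hj) Hne.
  move=> /(_ Hne Hjl); case E : (kids _) => [//|s' l] _.
  have : set_nth st0 st j s' \in dec_succ st.
    by apply/mem_dec_succ; exists j, s'; rewrite E mem_head.
  by case: (dec_succ st).
rewrite all_map; apply/allP => st' /mem_dec_succ[j [s' [Hj Hs' ->]]] /=; apply: IH.
apply/all_nth_state => j'; rewrite size_set_nth (maxn_idPr Hj) => Hj'.
move/all_nth_state: Hne => Hne; rewrite nth_set_nth /=.
by case: eqP => _; [exact: inhabited_kids (Hne _ Hj) Hs' | exact: Hne].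
Qed.

Definition cons_choice (i : nat) (cf : nat -> seq nat -> nat) (r : seq nat) : nat :=
  match r with [::] => i | b :: r' => cf b r' end.

(** * Safety games *)

(** The leaves played by [c] are the outcomes that the environment can still force, so one fixed
    strategy guarantees [P]. Honest play is found as a winning strategy rather than written down. *)
Definition win {L : eqType} (P : L -> Prop) (t : gtree L) : Prop :=
  exists2 c, valid_choice t c & forall x, x \in leaves t -> plays t c x.1 -> P x.2.

Lemma win_leaf (L : eqType) (P : L -> Prop) l : P l -> win P (Leaf l).
Proof. by move=> H; exists (fun=> 0%N) => [[|[|i] p] //|x]; rewrite inE => /eqP ->. Qed.

Lemma win_dec (L : eqType) (P : L -> Prop) cs i : inhabited_tree (Dec cs) ->
  (i < size cs)%N -> win P (nth_tree cs i) -> win P (Dec cs).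
Proof.
move=> Hne Hi [c Hc Hp].
exists (cons_choice i (fun b => if b == i then c else fun=> 0%N)).
  apply: valid_choice_node => //= b Hb; case: eqP => [->//|_].
  exact/valid_choice0/(inhabited_child _ _ _ Hne Hb).
move=> x /leaves_nodeP [//|b [p [Hb -> Hx]]]; rewrite plays_cons //= => /andP[/eqP ib].
by move: Hb Hx; rewrite -ib eqxx => Hb Hx pl; exact: Hp Hx pl.
Qed.

Lemma win_obs (L : eqType) (P : L -> Prop) cs :
  (forall i, (i < size cs)%N -> win P (nth_tree cs i)) -> win P (Obs cs).
Proof.
move=> H.
have /choice[cf Hcf] : forall i, exists c : seq nat -> nat, (i < size cs)%N ->
    valid_choice (nth_tree cs i) c /\
    forall x, x \in leaves (nth_tree cs i) -> plays (nth_tree cs i) c x.1 -> P x.2.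
  move=> i; case: (ltnP i (size cs)) => [/H [c ? ?]|_]; [by exists c | by exists (fun=> 0%N)].
exists (cons_choice 0 cf).
  by apply: valid_choice_node => //= i /Hcf [].
move=> x /leaves_nodeP [//|i [p [Hi -> Hx]]]; rewrite plays_cons //=.
by case: (Hcf i Hi) => _ /(_ _ Hx).
Qed.

(** Quantifying over every sufficient fuel lets moves compose without bookkeeping. *)
Definition win_state (P : seq (seq nat) -> Prop) (st : seq (tree * seq nat)) : Prop :=
  forall f, (state_size st < f)%N -> win P (itl f st).

Lemma win_state_leaf P st : all (fun s => is_leaf s.1) st -> P (map snd st) -> win_state P st.
Proof. by move=> H HP f _; rewrite itl_leaf //; exact: win_leaf. Qed.

Lemma win_state_dec P pre s post s' : all (fun s => inhabited_tree s.1) (pre ++ s :: post) ->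
  ~~ has (fun s => is_obs s.1) (pre ++ s :: post) -> s' \in kids s ->
  win_state P (pre ++ s' :: post) -> win_state P (pre ++ s :: post).
Proof.
move=> Hne Ho Hs' H [//|f] Hf.
have Hm : pre ++ s' :: post \in dec_succ (pre ++ s :: post).
  apply/mem_dec_succ; exists (size pre), s'.
  rewrite size_cat /= addnS ltnS leq_addr nth_cat ltnn subnn; split=> //.
  by elim: (pre) => //= x l <-.
have Hl : ~~ all (fun s => is_leaf s.1) (pre ++ s :: post).
  by rewrite all_cat /=; case: (s) Hs' => [[u|cs|cs] p]; rewrite ?andbF.
have := inhabited_itl f.+1 _ Hne; rewrite itl_dec // => Hne'.
apply: (win_dec _ _ _ (index (pre ++ s' :: post) (dec_succ (pre ++ s :: post)))) => //.
  by rewrite size_map index_mem.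
rewrite (nth_map [::]) ?index_mem // nth_index //; apply: H.
exact: leq_trans (state_size_dec_succ _ _ Hm) Hf.
Qed.

(** The environment moves all observing components at once. Honest play always keeps a single one of
    them, and then a joint move is just a child of that component. *)
Lemma win_state_obs P pre s post : is_obs s.1 ->
  ~~ has (fun s => is_obs s.1) (pre ++ post) ->
  (forall s', s' \in kids s -> win_state P (pre ++ s' :: post)) ->
  win_state P (pre ++ s :: post).
Proof.
move=> Hs Ho H [//|f] Hf.
have Hobs : has (fun s => is_obs s.1) (pre ++ s :: post) by rewrite has_cat /= Hs orbT.
rewrite itl_obs //; apply: win_obs => i; rewrite size_map => Hi.
rewrite (nth_map [::]) //; have Hm := mem_nth [::] Hi.
have := state_size_obs_succ _ _ Hobs Hm; case/mem_obs_succ: Hm.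
set st' := nth _ _ i => Hsz Hn Hlt.
have E : st' = pre ++ nth st0 st' (size pre) :: post.
  apply: (@eq_from_nth _ st0) => [|j Hj]; first by rewrite Hsz !size_cat.
  rewrite Hsz in Hj; move: (Hn _ Hj); rewrite !nth_cat.
  case: (ltngtP j (size pre)) => Hjp.
  - have : ~~ is_obs (nth st0 pre j).1.
      by move: Ho; rewrite has_cat negb_or => /andP[/hasPn Ho _]; apply: Ho; exact: mem_nth.
    by move/negbTE => ->; rewrite inE => /eqP.
  - have Hj' : (j - (size pre).+1 < size post)%N.
      by rewrite ltn_subLR // -(ltn_add2l 1) !add1n -addnS; move: Hj; rewrite size_cat /= addSn addnS.
    have -> : (j - size pre = (j - (size pre).+1).+1)%N by rewrite subnSK.
    have : ~~ is_obs (nth st0 post (j - (size pre).+1)).1.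
      by move: Ho; rewrite has_cat negb_or => /andP[_ /hasPn Ho]; apply: Ho; exact: mem_nth.
    by move=> /= /negbTE ->; rewrite inE => /eqP.
  - by rewrite Hjp subnn.
rewrite E; apply: H; last by rewrite -E; exact: leq_trans Hlt Hf.
have := Hn (size pre); rewrite size_cat /= addnS ltnS leq_addr nth_cat ltnn subnn /= Hs.
exact.
Qed.

(** * Simulation of interleaved play *)

(** With [F] the indicator of [outcome tY d z], this is coordinate [z] of the image of [d] under the
    mediator map of [c]. *)
Definition play_sum {R : realType} {L} (t : gtree L) (c : seq nat -> nat) (F : L -> R) : R :=
  \sum_(x <- leaves t) (plays t c x.1)%:R * F x.2.

Lemma play_sum_leaf (R : realType) L (l : L) c (F : L -> R) : play_sum (Leaf l) c F = F l.
Proof. by rewrite /play_sum big_seq1 mul1r. Qed.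

Lemma play_sum_obs (R : realType) L (cs : seq (gtree L)) c (F : L -> R) :
  play_sum (Obs cs) c F =
  \sum_(i < size cs) play_sum (nth_tree cs i) (fun r => c (val i :: r)) F.
Proof.
rewrite /play_sum sum_leaves_node //=; apply: eq_bigr => i _; apply: eq_bigr => x _.
by rewrite plays_cons.
Qed.

Lemma play_sum_dec (R : realType) L (cs : seq (gtree L)) c (F : L -> R) :
  (c [::] < size cs)%N ->
  play_sum (Dec cs) c F = play_sum (nth_tree cs (c [::])) (fun r => c (c [::] :: r)) F.
Proof.
move=> Hi; rewrite /play_sum sum_leaves_node //= (bigD1 (Ordinal Hi)) //= [X in _ + X]big1.
  rewrite addr0; apply: eq_bigr => x _; by rewrite plays_cons //= eqxx.
move=> i /negbTE Hne; apply: big1 => x _; rewrite plays_cons //=.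
by rewrite eq_sym -[val i == _]/(i == Ordinal Hi) Hne mul0r.
Qed.

Lemma play_sum0 (R : realType) (L : eqType) (t : gtree L) c (F : L -> R) :
  (forall x, x \in leaves t -> F x.2 = 0) -> play_sum t c F = 0.
Proof. by move=> H; apply: big1_seq => x /andP[_ /H ->]; rewrite mulr0. Qed.

(** For the pure vector of [d], the product over the mediators in [med] is a conjunction of such
    booleans, joined here with the condition on [z]. *)
Definition outcome (tY : tree) (d : seq nat -> nat) (z : seq nat) (lab : seq (seq nat)) : bool :=
  (head [::] lab == z) && all (plays tY d) (behead lab).

Lemma prefix_rcons_cat (p r : seq nat) a b : prefix (rcons p b) (p ++ a :: r) = (b == a).
Proof. by elim: p => /= [|x p ->]; rewrite ?eqxx // prefix0s andbT. Qed.

Lemma play_sum_outcome0 (R : realType) tY d f s0 ss c z :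
  ~~ (prefix s0.2 z && all (fun s => plays tY d s.2) ss) ->
  play_sum (itl f (s0 :: ss)) c (fun l => (outcome tY d z l)%:R : R) = 0.
Proof.
move=> H; apply: play_sum0 => x /leaves_itl_prefix[Hs Hp]; rewrite /outcome.
case: (boolP (_ && _)) => // /andP[/eqP Hz Hall]; case/negP: H.
have := Hp 0%N isT; rewrite /= nth0 Hz => -> /=.
apply/(all_nthP st0) => j Hj; have := Hp j.+1 Hj; case/prefixP => r E.
apply: (@plays_cat _ tY d _ r); rewrite -[_ ++ r]E -nth_behead.
by move/(all_nthP [::]): Hall; apply; rewrite size_behead Hs.
Qed.

Lemma uniq_cprod (A : eqType) (ls : seq (seq A)) : all uniq ls -> uniq (cprod ls).
Proof.
elim: ls => [//|l ls IH] /= /andP[H1 /IH H2]; apply: allpairs_uniq => //.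
by move=> [x r] [y s] _ _ /= [-> ->].
Qed.

Lemma uniq_kids s : uniq (kids s).
Proof.
rewrite map_inj_uniq ?iota_uniq // => i j [_ /eqP]; rewrite eqseq_rcons eqxx.
by move/eqP.
Qed.

Lemma uniq_obs_succ st : uniq (obs_succ st).
Proof.
apply: uniq_cprod; rewrite all_map; apply/allP => s _ /=.
by case: (is_obs _); [exact: uniq_kids | ].
Qed.

Lemma sum_nth_unique (R : nmodType) (A : eqType) (x0 a : A) (s : seq A) (F : nat -> R) :
  uniq s -> a \in s -> (forall i, (i < size s)%N -> nth x0 s i != a -> F i = 0) ->
  \sum_(i < size s) F i = F (index a s).
Proof.
move=> Hu Ha H; have Hi : (index a s < size s)%N by rewrite index_mem.
rewrite (bigD1 (Ordinal Hi)) //= big1 ?addr0 // => i Hne; apply: H => //.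
by apply: contraNneq Hne => E; rewrite -val_eqE /= -E index_uniq.
Qed.

Section Simulation.
Variables (R : realType) (tY : tree) (d : seq nat -> nat).
Hypothesis Hd : valid_choice tY d.

Definition on_play (s : tree * seq nat) : Prop :=
  subtree s.2 (dual tY) = Some s.1 /\ plays tY d s.2.

Lemma subtree_undual p u : subtree p (dual tY) = Some u -> subtree p tY = Some (dual u).
Proof. by move=> H; rewrite -[tY]dualK subtree_dual H. Qed.

(** An observation point of the dual component is a decision point of [Y], so [d] replies there. *)
Definition answer (s : tree * seq nat) : tree * seq nat :=
  if is_obs s.1 then (nth_tree (children s.1) (d s.2), rcons s.2 (d s.2)) else s.

Lemma answer_kid s : on_play s -> is_obs s.1 -> answer s \in kids s.
Proof.
case: s => -[//|//|cs] p [/= /subtree_undual Hp _] _; rewrite /answer /=.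
by apply: (mem_kids (Obs cs, p)); have := Hd _ _ Hp; rewrite size_map.
Qed.

Lemma on_play_kid s s' : on_play s -> ~~ is_obs s.1 -> s' \in kids s -> on_play s'.
Proof.
move=> [Hs Hp] Ho Hk; split; first exact: kids_subtree Hk.
case/kidsP: Hk => i Hi -> /=; rewrite plays_rcons Hp (subtree_undual _ _ Hs).
by case: (s.1) Ho.
Qed.

Lemma on_play_answer s : on_play s -> on_play (answer s).
Proof.
rewrite /answer; case Ho : (is_obs s.1) => // H.
have Hk := answer_kid _ H Ho; case: H => Hs Hp.
move: Hk; rewrite /answer Ho => Hk; split; first exact: kids_subtree Hk.
rewrite /= plays_rcons Hp (subtree_undual _ _ Hs).
by case: (s.1) Ho => //= cs _; rewrite eqxx.
Qed.

Lemma kid_answer s s' : on_play s -> is_obs s.1 -> s' \in kids s -> plays tY d s'.2 ->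
  s' = answer s.
Proof.
move=> [Hs Hp] Ho /kidsP[i Hi ->] /=; rewrite plays_rcons Hp (subtree_undual _ _ Hs) /answer Ho.
by case: (s.1) Ho => //= cs _ /eqP ->.
Qed.

Notation psum f st c z := (play_sum (itl f st) c (fun l => (outcome tY d z l)%:R : R)).

(** Of all joint moves of the environment only one contributes: the mediators must answer according
    to [d], and [X] must move towards [z]. *)
Lemma play_sum_obs_succ f s0 s0' ss c z :
  {in ss, forall s, on_play s} ->
  has (fun s => is_obs s.1) (s0 :: ss) ->
  s0' \in (if is_obs s0.1 then kids s0 else [:: s0]) ->
  (forall s, s \in (if is_obs s0.1 then kids s0 else [:: s0]) -> prefix s.2 z -> s = s0') ->
  let st' := s0' :: map answer ss in
  let i := index st' (obs_succ (s0 :: ss)) in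
  [/\ (i < size (obs_succ (s0 :: ss)))%N, nth [::] (obs_succ (s0 :: ss)) i = st' &
  psum f.+1 (s0 :: ss) c z = psum f st' (fun r => c (i :: r)) z].
Proof.
move=> Hss Hobs Hs0' Huniq st' i.
have Hm : st' \in obs_succ (s0 :: ss).
  apply/mem_obs_succ; rewrite /= size_map; split=> // -[//|j] /= Hj.
  have Hj' : nth st0 ss j \in ss by exact: mem_nth.
  rewrite (nth_map st0) //; case Ho : (is_obs _); first exact: answer_kid (Hss _ Hj') Ho.
  by rewrite /answer Ho mem_head.
have Hi : (i < size (obs_succ (s0 :: ss)))%N by rewrite index_mem.
split=> //; first exact: nth_index.
rewrite itl_obs // play_sum_obs size_map.
pose F j := play_sum (nth_tree [seq itl f i0 | i0 <- obs_succ (s0 :: ss)] j)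
   (fun r => c (j :: r)) (fun l => (outcome tY d z l)%:R : R).
rewrite -[LHS]/(\sum_(j < _) F j) (sum_nth_unique _ _ [::] st') //.
- by rewrite /F (nth_map [::]) // nth_index.
- exact: uniq_obs_succ.
- move=> j Hj; have := mem_nth [::] Hj; rewrite /F (nth_map [::]) //.
  case: (nth [::] _ j) => [|s' ss'] /mem_obs_succ[//= [Hsz] Hn] Hne.
  apply: play_sum_outcome0; apply: contra Hne => /andP[Hp Hall].
  rewrite (Huniq s' (Hn 0%N isT) Hp) /st'; apply/eqP; congr (_ :: _).
  apply: (@eq_from_nth _ st0) => [|k Hk]; first by rewrite size_map.
  have Hk' : (k < size ss)%N by rewrite -Hsz.
  rewrite (nth_map st0) //; have := Hn k.+1 Hk' => /=.
  have Hkss : nth st0 ss k \in ss by exact: mem_nth.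
  case Ho : (is_obs _); last by rewrite inE /answer Ho => /eqP.
  move=> Hk2; apply: kid_answer (Hss _ Hkss) Ho Hk2 _.
  by move/(all_nthP st0): Hall; apply.
Qed.

(** Against a fixed [d] every mediator reply is determined, so what [c] does inside [X] depends only
    on the observations made in [X], and this is a pure strategy [e]. Addresses in a state are
    absolute, hence the prefix [s0.2]. *)
Lemma simulate f s0 ss c :
  (state_size (s0 :: ss) < f)%N -> inhabited_tree s0.1 ->
  {in ss, forall s, on_play s} ->
  valid_choice (itl f (s0 :: ss)) c ->
  exists2 e, valid_choice s0.1 e &
    forall x, x \in leaves s0.1 -> psum f (s0 :: ss) c (s0.2 ++ x.1) = (plays s0.1 e x.1)%:R.
Proof.
elim: f s0 ss c => [//|f IH] s0 ss c Hf Hne Hss Hc.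
case: (boolP (all (fun s => is_leaf s.1) (s0 :: ss))) => [Hl|Hl].
  exists (fun=> 0%N); first exact: valid_choice0.
  move=> x; rewrite itl_leaf // play_sum_leaf /outcome /=.
  case: s0 Hl {Hf Hne Hc} => -[u|//|//] p0 _ /=; rewrite inE => /eqP -> /=; rewrite cats0 eqxx.
  by rewrite all_map (_ : all _ ss = true) //; apply/allP => s /Hss [].
case: (boolP (has (fun s => is_obs s.1) (s0 :: ss))) => [Ho|Ho].
  have Hss' : {in map answer ss, forall s, on_play s}.
    by move=> s /mapP[s' /Hss Hs' ->]; exact: on_play_answer.
  have Hsub s0' : s0' \in (if is_obs s0.1 then kids s0 else [:: s0]) ->
      let i := index (s0' :: map answer ss) (obs_succ (s0 :: ss)) in
      (i < size (obs_succ (s0 :: ss)))%N ->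
      nth [::] (obs_succ (s0 :: ss)) i = s0' :: map answer ss ->
      exists2 e, valid_choice s0'.1 e & forall x, x \in leaves s0'.1 ->
      psum f (s0' :: map answer ss) (fun r => c (i :: r)) (s0'.2 ++ x.1) = (plays s0'.1 e x.1)%:R.
    move=> Hs0' i Hi Hni; apply: IH => //.
    - rewrite -Hni; exact: leq_trans (state_size_obs_succ _ _ Ho (mem_nth _ Hi)) Hf.
    - by move: Hs0'; case: (is_obs _) => [/(inhabited_kids _ _ Hne)//|]; rewrite inE => /eqP ->.
    - rewrite -Hni -(nth_map [::] (Obs [::])) //.
      by move: Hc; rewrite itl_obs //; apply: (valid_choice_child _ (Obs _)); rewrite size_map.
  (* If [X] stays put while the mediators are answered, [e] is inherited from the one contributing
     successor. *)
  case Ho0 : (is_obs s0.1); last first.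
    have Hs0 : s0 \in (if is_obs s0.1 then kids s0 else [:: s0]) by rewrite Ho0 mem_head.
    have Huniq z s : s \in (if is_obs s0.1 then kids s0 else [:: s0]) -> prefix s.2 z -> s = s0.
      by rewrite Ho0 inE => /eqP.
    have [Hi Hni _] := play_sum_obs_succ f s0 s0 ss c [::] Hss Ho Hs0 (Huniq _).
    have [e He1 He2] := Hsub s0 Hs0 Hi Hni; exists e => // x Hx; rewrite -He2 //.
    by have [_ _ ->] := play_sum_obs_succ f s0 s0 ss c (s0.2 ++ x.1) Hss Ho Hs0 (Huniq _).
  (* At an observation point of [X] each child gets its own strategy; a target address below child
     [a] singles out the successor in which [X] moved to [a]. *)
  pose kid a := (nth_tree (children s0.1) a, rcons s0.2 a).
  have Hk a : (a < size (children s0.1))%N -> kid a \in (if is_obs s0.1 then kids s0 else [:: s0]).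
    by rewrite Ho0; exact: mem_kids.
  have Huniq a r s : s \in (if is_obs s0.1 then kids s0 else [:: s0]) ->
      prefix s.2 (s0.2 ++ a :: r) -> s = kid a.
    by rewrite Ho0 => /kidsP[b Hb ->] /=; rewrite prefix_rcons_cat => /eqP ->.
  have /choice[ec Hec] : forall a, exists e : seq nat -> nat, (a < size (children s0.1))%N ->
      valid_choice (kid a).1 e /\ forall x, x \in leaves (kid a).1 ->
      psum f.+1 (s0 :: ss) c (rcons s0.2 a ++ x.1) = (plays (kid a).1 e x.1)%:R.
    move=> a; case: (ltnP a (size (children s0.1))) => [Ha|_]; last by exists (fun=> 0%N).
    have [Hi Hni _] := play_sum_obs_succ f s0 (kid a) ss c _ Hss Ho (Hk a Ha) (Huniq a [::]).
    have [e He1 He2] := Hsub _ (Hk a Ha) Hi Hni; exists e => _; split=> // x Hx.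
    rewrite -He2 // cat_rcons.
    by have [_ _ ->] := play_sum_obs_succ f s0 (kid a) ss c _ Hss Ho (Hk a Ha) (Huniq a x.1).
  exists (cons_choice 0 ec).
    by apply: valid_choice_node => [|a /Hec []//]; case: (s0.1) Ho0.
  move=> x /leaves_nodeP []; first by case: (s0.1) Ho0.
  move=> a [p [Ha -> Hx]]; have [_ He] := Hec a Ha.
  rewrite -cat_rcons (He (p, x.2)) //= plays_cons //=.
  by congr (nat_of_bool _)%:R; case: (s0.1) Ho0.
move: Hc; rewrite itl_dec // => Hc; have := valid_choice_dec _ _ _ Hc.
rewrite size_map; set i := c [::] => Hi.
have Hm := mem_nth [::] Hi; have Hsz := state_size_dec_succ _ _ Hm.
have E z : play_sum (Dec [seq itl f i | i <- dec_succ (s0 :: ss)]) c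
    (fun l => (outcome tY d z l)%:R : R) =
    psum f (nth [::] (dec_succ (s0 :: ss)) i) (fun r => c (i :: r)) z.
  by rewrite play_sum_dec ?size_map // (nth_map [::]).
have Hci : valid_choice (itl f (nth [::] (dec_succ (s0 :: ss)) i)) (fun r => c (i :: r)).
  by rewrite -(nth_map [::] (Obs [::])) //; apply: (valid_choice_child _ (Dec _)); rewrite ?size_map.
have {}Hsz := leq_trans Hsz Hf.
case/mem_dec_succ: Hm => -[|j] [s' [/= Hj Hs' Est]].
  (* Here [c] moves in [X], and its child [a] becomes the root choice of [e]. *)
  move: E Hci Hsz; rewrite Est => E Hci Hsz.
  have [e He1 He2] := IH _ _ _ Hsz (inhabited_kids _ _ Hne Hs') Hss Hci.
  case/kidsP: Hs' => a Ha Es'.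
  exists (cons_choice a (fun b => if b == a then e else fun=> 0%N)).
    apply: valid_choice_node => //= b Hb; case: eqP => [->|_]; first by rewrite Es' in He1.
    exact/valid_choice0/(inhabited_child _ _ _ Hne Hb).
  move=> x /leaves_nodeP []; first by case: (s0.1) Ha.
  move=> b [p [Hb -> Hx]]; rewrite E plays_cons //=.
  have -> : (match s0.1 with Dec _ => a == b | _ => true end) = (a == b).
    by move: Ho Ha; rewrite /= negb_or => /andP[]; case: (s0.1).
  case: (altP (a =P b)) => [ab|ab].
    subst b; rewrite eqxx; have := He2 (p, x.2); rewrite Es' /= cat_rcons; exact.
  by rewrite play_sum_outcome0 // Es' prefix_rcons_cat (negbTE ab).
move: E Hci Hsz; rewrite Est => E Hci Hsz.
(* Here [c] moves in a mediator. The node is an observation point of [Y], where [d] prescribes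
   nothing, so the component stays on the play and [e] is unchanged. *)
have Hss' : {in set_nth st0 ss j s', forall s, on_play s}.
  move=> s /(nthP st0) [k]; rewrite size_set_nth (maxn_idPr (Hj : j < size ss)%N) nth_set_nth /= => Hk.
  case: eqP => [_ <-|_ <-]; last exact/Hss/mem_nth.
  apply: on_play_kid Hs'; first exact/Hss/mem_nth.
  by move: Ho; rewrite /= negb_or => /andP[_ /hasPn]; apply; exact: mem_nth.
have [e He1 He2] := IH _ _ _ Hsz Hne Hss' Hci.
by exists e => // x Hx; rewrite E He2.
Qed.

End Simulation.

(** * Mediated maps of interleaved strategies *)

(** The fuel exceeds the state size, which drops at every move, so a leaf of [itl] is a genuine
    terminal state and never an exhausted recursion. *)
Lemma leaves_itl_subtree f st ts x : (state_size st < f)%N ->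
  (forall j, (j < size st)%N ->
     subtree (nth st0 st j).2 (nth (Leaf tt) ts j) = Some (nth st0 st j).1) ->
  x \in leaves (itl f st) -> forall j, (j < size st)%N ->
  subtree (nth [::] x.2 j) (nth (Leaf tt) ts j) = Some (Leaf tt).
Proof.
elim: f st x => [//|f IH] st x Hf Hst.
case: (boolP (all (fun s => is_leaf s.1) st)) => [Hl|Hl].
  rewrite itl_leaf // inE => /eqP -> /= j Hj; rewrite (nth_map st0) // Hst //.
  by move/all_nth_state: Hl => /(_ j Hj); case: (_.1) => // -[].
case: (boolP (has (fun s => is_obs s.1) st)) => [Ho|Ho].
  rewrite itl_obs // => /leaves_nodeP [//|i [p]] /=; rewrite size_map => -[Hi _].
  rewrite (nth_map [::]) // => Hx j Hj.
  have Hlt := state_size_obs_succ _ _ Ho (mem_nth [::] Hi).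
  have /mem_obs_succ[Hs' Hn] := mem_nth [::] Hi.
  have {}Hx := IH _ _ (leq_trans Hlt Hf) _ Hx; apply: Hx; rewrite Hs' // => j' Hj'.
  have := Hn _ Hj'; case: (is_obs _) => [|]; first exact/kids_subtree/Hst.
  by rewrite inE => /eqP ->; exact: Hst.
rewrite itl_dec // => /leaves_nodeP [//|i [p]] /=; rewrite size_map => -[Hi _].
rewrite (nth_map [::]) // => Hx j Hj.
have Hm := mem_nth [::] Hi; have Hs' := size_dec_succ _ _ Hm.
have Hlt := state_size_dec_succ _ _ Hm.
have {}Hx := IH _ _ (leq_trans Hlt Hf) _ Hx; apply: Hx; rewrite Hs' // => j2 Hj2.
case/mem_dec_succ: Hm => j' [s' [Hj' Hk ->]]; rewrite nth_set_nth /=.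
by case: eqP => [->|_]; [exact: kids_subtree (Hst _ Hj') Hk | exact: Hst].
Qed.

Definition term_label (tX tY : tree) k (zz : TS tX tY k) : seq (seq nat) :=
  addr tX zz.1 :: [seq addr tY (zz.2 i) | i <- enum 'I_k].

Lemma term_label_inj tX tY k : injective (@term_label tX tY k).
Proof.
move=> [z zs] [z' zs'] [/addr_inj /= -> /eq_in_map H]; congr pair.
by apply/ffunP => i; apply: (@addr_inj _ tY); apply: H; rewrite mem_enum.
Qed.

Lemma state_size_init tX tY k :
  (state_size [seq (t, [::]) | t <- tX :: nseq k (dual tY)]
   < (sumn (map Defs.tsize (tX :: nseq k (dual tY)))).+1)%N.
Proof. by rewrite /state_size -map_comp. Qed.

Lemma leaves_interleave tX tY k x : x \in leaves (interleave tX tY k) ->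
  exists zz : TS tX tY k, x.2 = term_label tX tY k zz.
Proof.
pose ts := tX :: nseq k (dual tY).
move=> Hx; have [Hsz _] := leaves_itl_prefix _ _ _ Hx.
have := leaves_itl_subtree _ _ ts _ (state_size_init tX tY k) _ Hx.
rewrite size_map /= size_nseq in Hsz => H.
have {}H : forall j, (j < k.+1)%N ->
    subtree (nth [::] x.2 j) (nth (Leaf tt) ts j) = Some (Leaf tt).
  move=> j Hj; apply: H => [j'|]; last by rewrite size_map /= size_nseq.
  by rewrite size_map => Hj'; rewrite (nth_map (Leaf tt)).
case: x Hx Hsz H => p [//|a0 as_] /= Hx [Hsz] H.
have [z Hz] : exists z : Z tX, addr tX z = a0.
  have /subtree_leaf/leaves_addr[z [Hz _]] := H 0%N isT.
  by exists z.
have [zs Hzs] : exists zs : {ffun 'I_k -> Z tY}, forall i : 'I_k, addr tY (zs i) = nth [::] as_ i.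
  have /choice[zs Hzs] : forall i : 'I_k, exists z : Z tY, addr tY z = nth [::] as_ i.
    move=> i; have := H i.+1 (ltn_ord i); rewrite /= nth_nseq ltn_ord.
    move=> /subtree_undual/subtree_leaf/leaves_addr[z' [Hz' _]].
    by exists z'.
  by exists (finfun zs) => i; rewrite ffunE.
exists (z, zs); rewrite /term_label /= Hz; congr (_ :: _).
apply: (@eq_from_nth _ [::]) => [|i Hi]; first by rewrite size_map size_enum_ord.
rewrite Hsz in Hi; rewrite (nth_map (Ordinal Hi)) ?size_enum_ord // Hzs.
by rewrite nth_enum_ord.
Qed.

Lemma prod_natb (R : comPzRingType) k (b : 'I_k -> bool) :
  \prod_(i < k) (b i)%:R = ([forall i, b i])%:R :> R.
Proof.
case: forallP => [H|/forallP]; first by apply: big1 => i _; rewrite H.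
rewrite negb_forall => /existsP[i /negbTE Hi].
by rewrite (bigD1 i) //= Hi mul0r.
Qed.

(** Each leaf of the interleaving is labelled by exactly one terminal state, so after exchanging the
    sums only one tuple [zs] receives its weight. *)
Lemma med_outcome (R : realType) tX tY k (q : {ffun TS tX tY k -> R}) d
    (x : {ffun Z (interleave tX tY k) -> R}) :
  (forall zz, q zz = \sum_(l : Z (interleave tX tY k)
       | label (interleave tX tY k) l
           == addr tX zz.1 :: [seq addr tY (zz.2 i) | i <- enum 'I_k]) x l) ->
  forall z, med tX tY k q (vR tY (pure_vec tY d)) z =
    \sum_l x l * (outcome tY d (addr tX z) (label (interleave tX tY k) l))%:R.
Proof.
move=> Hq z; rewrite ffunE.
under eq_bigr => zs _ do rewrite Hq big_mkcond mulr_suml.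
rewrite exchange_big /=; apply: eq_bigr => l _.
have [[z0 zs0] E] := leaves_interleave _ _ _ _ (addr_leaves _ _ l).
rewrite /= in E; rewrite (bigD1 zs0) //= [X in _ + X]big1 ?addr0 => [|zs Hzs].
- rewrite E; rewrite -[_ :: _]/(term_label tX tY k (z, zs0)) (inj_eq (@term_label_inj _ _ _)).
  rewrite /outcome /= (inj_eq (@addr_inj _ _)) xpair_eqE eqxx andbT.
  case: eqP => _ /=; last by rewrite mul0r mulr0.
  congr (_ * _); under eq_bigr => i _ do rewrite !ffunE.
  rewrite prod_natb all_map; congr (nat_of_bool _)%:R.
  apply/forallP/allP => [H i _|H i]; first exact: H.
  by apply: H; rewrite mem_enum.
- rewrite E -[_ :: _]/(term_label tX tY k (z, zs)) (inj_eq (@term_label_inj _ _ _)).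
  by rewrite xpair_eqE [zs0 == zs]eq_sym (negbTE Hzs) andbF mul0r.
Qed.

Lemma in_co_mix (R : realType) L (t : gtree L) (I : finType) (lam : I -> R)
    (v : I -> {ffun Z t -> R}) (w : {ffun Z t -> R}) :
  (forall i, 0 <= lam i) -> \sum_i lam i = 1 ->
  (forall i, lam i != 0 -> in_co t (v i)) ->
  (forall z, w z = \sum_i lam i * v i z) -> in_co t w.
Proof.
move=> Hlam0 Hlam1 Hv Hw.
have /choice[mu Hmu] : forall i, exists mu : {ffun {ffun Z t -> bool} -> R}, lam i != 0 ->
   [/\ forall x, 0 <= mu x, forall x, mu x != 0 -> is_pure t x,
       \sum_x mu x = 1 & forall z, v i z = \sum_x mu x * (x z)%:R].
  move=> i; case: (boolP (lam i == 0)) => [_|/Hv [mu Hmu]]; last by exists mu.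
  by exists 0.
exists [ffun x => \sum_i lam i * mu i x]; split=> [x|x||z].
- rewrite ffunE; apply: sumr_ge0 => i _; case: (eqVneq (lam i) 0) => [->|/Hmu [H _ _ _]].
    by rewrite mul0r.
  exact: mulr_ge0.
- rewrite ffunE; apply: contra_neqP => Hx; apply: big1 => i _.
  case: (eqVneq (lam i) 0) => [->|/Hmu [_ H _ _]]; first by rewrite mul0r.
  by case: (eqVneq (mu i x) 0) => [->|/H //]; rewrite mulr0.
- under eq_bigr => x _ do rewrite ffunE.
  rewrite exchange_big /= -[RHS]Hlam1; apply: eq_bigr => i _; rewrite -mulr_sumr.
  case: (eqVneq (lam i) 0) => [->|/Hmu [_ _ -> _]]; first by rewrite mul0r.
  by rewrite mulr1.
- rewrite Hw; under [RHS]eq_bigr => x _ do rewrite ffunE mulr_suml.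
  rewrite exchange_big /=; apply: eq_bigr => i _.
  case: (eqVneq (lam i) 0) => [->|/Hmu [_ _ _ ->]].
    by rewrite mul0r big1 // => x _; rewrite !mul0r.
  by rewrite mulr_sumr; apply: eq_bigr => x _; rewrite mulrA.
Qed.

Lemma in_co_pure (R : realType) L (t : gtree L) (x : {ffun Z t -> bool}) :
  is_pure t x -> in_co t (vR t x : {ffun Z t -> R}).
Proof.
move=> Hx; exists [ffun x' => (x' == x)%:R]; split=> [x'|x'||z].
- by rewrite ffunE ler0n.
- by rewrite ffunE; case: (x' =P x) => [->|_] //=; rewrite eqxx.
- rewrite (bigD1 x) //= ffunE eqxx big1 ?addr0 // => x' /negbTE.
  by rewrite ffunE => ->.
- rewrite (bigD1 x) //= !ffunE eqxx big1 ?addr0 ?mul1r // => x' /negbTE.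
  by rewrite ffunE => ->; rewrite mul0r.
Qed.

Definition pure_reduced {R : realType} tX tY k (c : seq nat -> nat) : {ffun TS tX tY k -> R} :=
  [ffun zz : TS tX tY k => \sum_(l : Z (interleave tX tY k)
     | label (interleave tX tY k) l == addr tX zz.1 :: [seq addr tY (zz.2 i) | i <- enum 'I_k])
       vR _ (pure_vec (interleave tX tY k) c) l].

Lemma reduced_pure (R : realType) tX tY k c : valid_choice (interleave tX tY k) c ->
  reduced tX tY k (pure_reduced tX tY k c : {ffun TS tX tY k -> R}).
Proof.
move=> Hc; exists (vR _ (pure_vec _ c)); split; last by move=> zz; rewrite ffunE.
by apply: in_co_pure; exists c.
Qed.

(** A coordinate equal to 1 is a sum over leaves of the interleaving with a non-zero term; the leaf
    found this way transports to [e] whatever [c] guarantees about labels. *)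
Lemma med_pure_reduced (R : realType) tX tY k c d :
  inhabited_tree tX -> valid_choice (interleave tX tY k) c -> valid_choice tY d ->
  exists2 e, valid_choice tX e &
    med tX tY k (pure_reduced tX tY k c) (vR tY (pure_vec tY d))
      = vR tX (pure_vec tX e) :> {ffun Z tX -> R}
    /\ forall x, x \in leaves tX -> plays tX e x.1 ->
       exists2 l, l \in leaves (interleave tX tY k) &
         plays (interleave tX tY k) c l.1 && outcome tY d x.1 l.2.
Proof.
move=> HX Hc Hd.
have [|e He1 He2] := simulate R tY d Hd _ (tX, [::]) [seq (t, [::]) | t <- nseq k (dual tY)] c
   (state_size_init tX tY k) HX _ Hc.
  move=> s /mapP[t]; rewrite mem_nseq => /andP[_ /eqP ->] ->; split=> //=.
exists e => //; split.
  apply/ffunP => z; rewrite (med_outcome _ _ _ _ _ d (vR _ (pure_vec (interleave tX tY k) c))); last first.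
    by move=> zz; rewrite ffunE.
  rewrite !ffunE -(He2 (addr tX z, label tX z)); last exact: addr_leaves.
  rewrite /play_sum -sum_Z; apply: eq_bigr => l _; rewrite !ffunE //.
move=> x Hx Hpl; have := He2 _ Hx; rewrite Hpl /play_sum => E.
have : \sum_(l <- leaves (interleave tX tY k))
   (plays (interleave tX tY k) c l.1)%:R * (outcome tY d x.1 l.2)%:R != 0 :> R.
  by rewrite E oner_neq0.
move=> H; apply: contraPP H => Hno; apply/negP; rewrite negbK; apply/eqP.
apply: big1_seq => l /andP[_ Hl]; rewrite -natrM mulnb.
case: (boolP (_ && _)) => // Hb; case: Hno; exists l => //.
Qed.

(** [med] is linear in [q], so a mixture of pure strategies of the interleaving yields the same
    mixture of the pure images found by simulation. *)
Lemma med_in_co (R : realType) tX tY k (q : {ffun TS tX tY k -> R}) y :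
  inhabited_tree tX -> reduced tX tY k q -> is_pure tY y ->
  in_co tX (med tX tY k q (vR tY y)).
Proof.
move=> HX [x [[lam [Hlam0 Hlamp Hlam1 Hx]] Hq]] [d [Hd ->]].
have /choice[v Hv] : forall xi, exists v : {ffun Z tX -> R}, lam xi != 0 ->
    in_co tX v /\ forall z, v z = \sum_l (xi l)%:R *
     (outcome tY d (addr tX z) (label (interleave tX tY k) l))%:R.
  move=> xi; case: (eqVneq (lam xi) 0) => [_|/Hlamp [c [Hc ->]]]; first by exists 0.
  have [e He [Em _]] := med_pure_reduced R tX tY k c d HX Hc Hd.
  exists (vR tX (pure_vec tX e)) => _; split; first by apply: in_co_pure; exists e.
  move=> z; rewrite -Em (med_outcome _ _ _ _ _ d (vR _ (pure_vec (interleave tX tY k) c))).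
    by apply: eq_bigr => l _; rewrite !ffunE.
  by move=> zz; rewrite ffunE.
apply: (in_co_mix _ _ _ _ lam v) => // [xi /Hv []//|z].
rewrite (med_outcome _ _ _ _ _ d x) //.
under eq_bigr => l _ do rewrite Hx mulr_suml.
rewrite exchange_big /=; apply: eq_bigr => xi _.
case: (eqVneq (lam xi) 0) => [->|/Hv [_ ->]].
  by rewrite mul0r big1 // => l _; rewrite !mul0r.
by rewrite mulr_sumr; apply: eq_bigr => l _; rewrite mulrA.
Qed.

(** * The encrypted decision problem *)

Section Encryption.
Variables D k : nat.

(** [d] counts the remaining rounds, each an answer followed by the next observation. The node is
    entered just after an observation, the first one being the root move of [cipher_tree]. *)
Fixpoint relay (d : nat) : tree :=
  if d is d'.+1 then Dec (nseq D.+1 (Obs (nseq D.+1 (relay d')))) else Leaf tt.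

(** Observation histories suffice as indices because a strategy's own earlier answers are determined
    by them. Bounded sequences keep the group finite, so a uniform pad exists. *)
Definition pad : Type := {ffun D.-bseq 'I_D.+1 -> 'I_D.+1}.
HB.instance Definition _ := GRing.Zmodule.on pad.
HB.instance Definition _ := Finite.on pad.

Definition key : Type := {ffun 'I_k -> pad}.
HB.instance Definition _ := GRing.Zmodule.on key.
HB.instance Definition _ := Finite.on key.

Definition share_tree : tree := Dec (nseq #|{: pad}| (Leaf tt)).

(* At the root of the problem the environment either opens the relay with a first observation
   (children [0 .. D]) or asks for one of the [k] shares (children [D.+1 + j]);
   the number of mediators is [k.+1]. *)
Definition cipher_tree : tree := Obs (nseq D.+1 (relay D) ++ nseq k share_tree).

(* Relay addresses alternate observations (even positions) and answers. *)
Fixpoint obs_of (a : seq nat) : seq nat :=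
  match a with
  | o :: _ :: a' => o :: obs_of a'
  | _ => a
  end.

(** Sequences longer than [D] fall back to a default index; wherever the relay still expects an
    answer, at most [D] observations have been made. *)
Definition pad_index (os : seq nat) : D.-bseq 'I_D.+1 := insub_bseq D (map inord os).

(** The masked table [w] and the shares [ks] are separate arguments so that the secrecy arguments
    can change one and keep the other. *)
Definition cipher (w : pad) (ks : key) (a : seq nat) : nat :=
  if (head 0%N a < D.+1)%N then nat_of_ord (w (pad_index (obs_of a)))
  else if insub (head 0%N a - D.+1)%N is Some j then nat_of_ord (enum_rank (ks j)) else 0%N.

Lemma tree_form_decE L (cs : seq (gtree L)) : tree_form (Dec cs) =
  (0 < size cs)%N && all (fun c => ~~ is_dec c) cs && all tree_form cs.
Proof. by []. Qed.

Lemma tree_form_obsE L (cs : seq (gtree L)) : tree_form (Obs cs) =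
  (0 < size cs)%N && all (fun c => ~~ is_obs c) cs && all tree_form cs.
Proof. by []. Qed.

Lemma relayS d : relay d.+1 = Dec (nseq D.+1 (Obs (nseq D.+1 (relay d)))).
Proof. by []. Qed.

Lemma tree_form_relay d : tree_form (relay d) && ~~ is_obs (relay d).
Proof.
elim: d => [//|d /andP[IH1 IH2]]; rewrite relayS andbT.
by rewrite tree_form_decE !all_nseq tree_form_obsE !all_nseq IH1 IH2 !size_nseq !orbT.
Qed.

Lemma tree_form_cipher_tree : tree_form cipher_tree.
Proof.
have /andP[H1 H2] := tree_form_relay D; have M : (0 < #|{: pad}|)%N.
  by apply/card_gt0P; exists 0.
rewrite /cipher_tree tree_form_obsE size_cat size_nseq addSn !all_cat !all_nseq H1 H2.
by rewrite tree_form_decE size_nseq M !all_nseq !orbT.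
Qed.

Lemma inhabited_cipher_tree : inhabited_tree cipher_tree.
Proof. exact/tree_form_inhabited/tree_form_cipher_tree. Qed.

Lemma children_dec L (cs : seq (gtree L)) : children (Dec cs) = cs.
Proof. by []. Qed.

Lemma children_obs L (cs : seq (gtree L)) : children (Obs cs) = cs.
Proof. by []. Qed.

Lemma subtree_seq1 L i (t : gtree L) : subtree [:: i] t = onth (children t) i.
Proof. by rewrite /=; case: (onth _ _). Qed.

Lemma subtree_cipher_relay o : (o < D.+1)%N -> subtree [:: o] cipher_tree = Some (relay D).
Proof.
by move=> Ho; rewrite subtree_seq1 children_obs onth_cat size_nseq Ho onth_nseq Ho.
Qed.

Lemma subtree_cipher_share (j : 'I_k) :
  subtree [:: (D.+1 + j)%N] cipher_tree = Some share_tree.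
Proof.
rewrite subtree_seq1 children_obs onth_cat size_nseq ltnNge leq_addr [~~ true]/= addKn.
by rewrite onth_nseq ltn_ord.
Qed.

Lemma subtree_relay d q m o : subtree q cipher_tree = Some (relay d.+1) ->
  (m < D.+1)%N -> (o < D.+1)%N -> subtree (rcons (rcons q m) o) cipher_tree = Some (relay d).
Proof.
rewrite relayS => H Hm Ho.
have Hq : subtree (rcons q m) cipher_tree = Some (Obs (nseq D.+1 (relay d))).
  by rewrite (subtree_rcons _ _ _ _ _ H) children_dec ?size_nseq // nth_nseq Hm.
by rewrite (subtree_rcons _ _ _ _ _ Hq) children_obs ?size_nseq // nth_nseq Ho.
Qed.

Lemma valid_choice_leaf (L : Type) (l : L) c : valid_choice (Leaf l) c.
Proof. by move=> [//|[|i] p]. Qed.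

Lemma valid_relay d c : (forall r, (c r < D.+1)%N) -> valid_choice (relay d) c.
Proof.
elim: d c => [|d IH] c Hc; first exact: valid_choice_leaf.
rewrite relayS; apply: valid_choice_node => [_|i]; first by rewrite children_dec size_nseq.
rewrite children_dec size_nseq => Hi; rewrite nth_nseq Hi; apply: valid_choice_node => [//|j].
by rewrite children_obs size_nseq => Hj; rewrite nth_nseq Hj; apply: IH.
Qed.

Lemma cipher_relayE w ks o r : (o < D.+1)%N ->
  cipher w ks (o :: r) = w (pad_index (obs_of (o :: r))).
Proof. by rewrite /cipher [head _ _]/= => ->. Qed.

Lemma cipher_shareE w ks (j : 'I_k) r : cipher w ks ((D.+1 + j)%N :: r) = enum_rank (ks j).
Proof. by rewrite /cipher [head _ _]/= ltnNge leq_addr /= addKn valK. Qed.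

Lemma valid_cipher w ks : valid_choice cipher_tree (cipher w ks).
Proof.
apply: valid_choice_node => [//|i]; rewrite children_obs size_cat !size_nseq nth_cat size_nseq.
case: (ltnP i D.+1) => [Hi|Hi] Hi2.
  by rewrite nth_nseq Hi; apply: valid_relay => r; rewrite cipher_relayE.
have Hik : (i - D.+1 < k)%N by rewrite ltn_subLR.
rewrite nth_nseq Hik -(subnKC Hi) -[(i - _)%N]/(val (Ordinal Hik)).
apply: valid_choice_node => [_|j].
  by rewrite children_dec size_nseq cipher_shareE.
rewrite children_dec size_nseq => Hj; rewrite nth_nseq Hj; exact: valid_choice_leaf.
Qed.

Lemma plays_cipher_share w ks (j : 'I_k) v :
  plays cipher_tree (cipher w ks) [:: (D.+1 + j)%N; v] = (val (enum_rank (ks j)) == v).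
Proof.
rewrite -[[:: _; v]]/(rcons [:: _] v) plays_rcons subtree_cipher_share cipher_shareE.
by rewrite -[[:: _]]/(rcons [::] _) plays_rcons plays_nil.
Qed.

Lemma plays_cipher_relay w ks ks' o r : (o < D.+1)%N ->
  plays cipher_tree (cipher w ks) (o :: r) = plays cipher_tree (cipher w ks') (o :: r).
Proof.
move=> Ho; rewrite !plays_cons ?children_obs ?size_cat ?size_nseq ?ltn_addr //.
by congr (_ && _); apply: plays_ext => a; rewrite !cipher_relayE.
Qed.

(** * Encrypting and decrypting one player's strategy *)

Section Player.
Variable T : tree.
Hypotheses (HT : tree_form T) (HTD : (Defs.tsize T <= D.+1)%N).

(** Relay symbols take [D.+1] values whatever the arity of the node of [T]; reading an excess value
    as child 0 keeps every run inside [T]. *)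
Definition clamp (n i : nat) : nat := if (i < n)%N then i else 0%N.

Definition observe (s : tree * seq nat) (o : nat) : tree * seq nat :=
  if is_obs s.1 then
    let o' := clamp (size (children s.1)) o in (nth_tree (children s.1) o', rcons s.2 o')
  else s.

Definition act (e : seq nat -> nat) (s : tree * seq nat) : tree * seq nat :=
  if is_dec s.1 then (nth_tree (children s.1) (e s.2), rcons s.2 (e s.2)) else s.

(* The node that [e] has reached after the observations [os]: the first one precedes any action, and
   rounds in which nothing is observed report an arbitrary value, which [observe] ignores. *)
Definition cur (e : seq nat -> nat) (os : seq nat) : tree * seq nat :=
  foldl (fun s o => observe (act e s) o) (observe (T, [::]) (head 0%N os)) (behead os).

(** The relay expects an answer in every round, even after [T] has ended; a dummy 0 is sent then. *)
Definition message (e : seq nat -> nat) (s : tree * seq nat) : nat :=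
  if is_dec s.1 then e s.2 else 0%N.

Definition plain (e : seq nat -> nat) : pad :=
  [ffun b : D.-bseq 'I_D.+1 => inord (message e (cur e (map val (bseqval b))))].

Definition key_sum (ks : key) : pad := \sum_j ks j.

Definition encrypt (e : seq nat -> nat) (ks : key) : seq nat -> nat :=
  cipher (key_sum ks + plain e) ks.

Definition reached (e : seq nat -> nat) (s : tree * seq nat) : Prop :=
  subtree s.2 T = Some s.1 /\ plays T e s.2.

Lemma inhabited_player : inhabited_tree T. Proof. exact: tree_form_inhabited. Qed.

Lemma clamp_lt n i : (0 < n)%N -> (clamp n i < n)%N.
Proof. by rewrite /clamp; case: (ltnP i n). Qed.

Lemma children_gt0 (t : tree) : inhabited_tree t -> ~~ is_leaf t -> (0 < size (children t))%N.
Proof. by case: t => //= cs /andP[]. Qed.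

Lemma reached_observe e s o : reached e s -> reached e (observe s o).
Proof.
move=> [Hs Hp]; rewrite /observe; case Ho : (is_obs s.1); last by split.
have Hi : (0 < size (children s.1))%N.
  by apply: children_gt0; [exact: inhabited_subtree inhabited_player Hs | case: (s.1) Ho].
split; first exact: subtree_rcons Hs (clamp_lt _ _ Hi).
by rewrite /= plays_rcons Hp Hs; case: (s.1) Ho.
Qed.

Lemma reached_act e s : valid_choice T e -> reached e s -> reached e (act e s).
Proof.
move=> He [Hs Hp]; rewrite /act; case Ho : (is_dec s.1); last by split.
have Hi : (e s.2 < size (children s.1))%N by case: (s.1) Ho Hs => // cs _ /He.
split; first exact: subtree_rcons Hs Hi.
by rewrite /= plays_rcons Hp Hs; case: (s.1) Ho => //=; rewrite eqxx.
Qed.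

Lemma reached_cur e os : valid_choice T e -> reached e (cur e os).
Proof.
move=> He; rewrite /cur; have : reached e (observe (T, [::]) (head 0%N os)).
  exact: reached_observe.
elim: (behead os) (observe _ _) => [//|o os' IH] s Hs /=; apply: IH.
exact/reached_observe/reached_act.
Qed.

Lemma cur_rcons e os o : (0 < size os)%N -> cur e (rcons os o) = observe (act e (cur e os)) o.
Proof. by case: os => // o0 os _; rewrite /cur /= foldl_rcons. Qed.

Lemma pad_indexK os : (size os <= D)%N -> all (fun o => o < D.+1)%N os ->
  map val (bseqval (pad_index os)) = os.
Proof.
move=> Hs Ha; rewrite /pad_index /insub_bseq insubdK; last by rewrite unfold_in /= size_map.
by rewrite -map_comp map_id_in // => o /(allP Ha) Ho /=; rewrite inordK.
Qed.

Definition decode (ks : key) (os : seq nat) (m : nat) : nat :=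
  nat_of_ord ((inord m : 'I_D.+1) - key_sum ks (pad_index os))%R.

(** The equation [size os + d = D.+1] gives [size os <= D] whenever a round is left, so the pad is
    never read at the default index. Odd length of [q] says that its last entry is an
    observation. *)
Definition relay_node (d : nat) (q os : seq nat) : Prop :=
  [/\ subtree q cipher_tree = Some (relay d), os = obs_of q, odd (size q),
      (0 < size os)%N && (size os + d == D.+1)%N & all (fun o => o < D.+1)%N os].

Lemma obs_of_rcons q m o : odd (size q) -> obs_of (rcons (rcons q m) o) = rcons (obs_of q) o.
Proof.
have [n] := ubnP (size q); elim: n q => // n IH [//|a [//|b q]] /=; rewrite ltnS negbK => Hn Ho.
by rewrite IH // ltnW.
Qed.

Lemma relay_node_rcons d q os m o : relay_node d.+1 q os -> (m < D.+1)%N -> (o < D.+1)%N ->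
  relay_node d (rcons (rcons q m) o) (rcons os o).
Proof.
move=> [H1 H2 H3 /andP[H4 H5] H6] Hm Ho; split.
- exact: subtree_relay.
- by rewrite H2 obs_of_rcons.
- by rewrite !size_rcons /= H3.
- by rewrite size_rcons addSn -addnS H5.
- by rewrite all_rcons Ho.
Qed.

Lemma relay_node_head o : (o < D.+1)%N -> relay_node D [:: o] [:: o].
Proof. by move=> Ho; split=> //=; rewrite ?Ho ?add1n // -(subtree_cipher_relay o). Qed.

Lemma message_lt e s : valid_choice T e -> reached e s -> (message e s < D.+1)%N.
Proof.
move=> He [Hs _]; rewrite /message; case Ho : (is_dec s.1) => //.
have Hi : (e s.2 < size (children s.1))%N by case: (s.1) Ho Hs => // cs _ /He.
apply: leq_trans HTD; apply: leq_trans Hi _.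
have := size_children_tsize _ s.1; move/ltnW/leq_trans; apply.
elim: (s.2) (T) Hs => [|i p IH] t; first by case=> ->.
case Hi2 : (i < size (children t))%N; last by rewrite /= onth_default // leqNgt Hi2.
rewrite subtree_cons // => /IH /leq_trans; apply; exact/ltnW/ltn_tsize_child.
Qed.

Lemma encrypt_relay e ks d q os m : valid_choice T e -> relay_node d.+1 q os -> (m < D.+1)%N ->
  (encrypt e ks q == m) = (decode ks os m == message e (cur e os)).
Proof.
move=> He [H1 H2 H3 /andP[H4 /eqP H5] H6] Hm.
have Hq : (head 0%N q < D.+1)%N.
  by move: H6; rewrite H2; case: (q) H3 => [|a [|b r]] //= _ /andP[].
rewrite /encrypt /cipher Hq -H2 !ffunE pad_indexK //; last first.
  by rewrite -ltnS -H5 addnS ltnS leq_addr.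
set x := message e _; have Hx : (x < D.+1)%N := message_lt _ _ He (reached_cur _ _ He).
have -> : (decode ks os m == x) = (inord m - key_sum ks (pad_index os) == inord x :> 'I_D.+1)%R.
  by rewrite -{1}(inordK Hx) -(inj_eq val_inj).
rewrite -{1}(inordK Hm) -[RHS]eq_sym -[LHS]/(val _ == val _) (inj_eq val_inj).
by rewrite eq_sym [RHS]eq_sym subr_eq addrC.
Qed.

(** * Honest play *)

(** The honest player knows neither [e] nor [ks], so the goal is a property of the terminal state
    alone: every strategy whose encryption is consistent with the mediator leaves must play the leaf
    of [X]. *)
Definition recovers (lab : seq (seq nat)) : Prop :=
  forall e ks, valid_choice T e -> all (plays cipher_tree (encrypt e ks)) (behead lab) ->
    plays T e (head [::] lab).

Definition share_state (ks : key) (j : 'I_k) : tree * seq nat :=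
  (Leaf tt, [:: (D.+1 + j)%N; nat_of_ord (enum_rank (ks j))]).

Lemma plays_relay_rcons e ks d q m o : subtree q cipher_tree = Some (relay d.+1) ->
  (m < D.+1)%N -> (o < D.+1)%N ->
  plays cipher_tree (encrypt e ks) (rcons (rcons q m) o) =
  plays cipher_tree (encrypt e ks) q && (encrypt e ks q == m).
Proof.
move=> Hq Hm Ho; rewrite plays_rcons.
have -> : subtree (rcons q m) cipher_tree = Some (Obs (nseq D.+1 (relay d))).
  by rewrite (subtree_rcons _ _ _ _ _ Hq) relayS children_dec ?size_nseq // nth_nseq Hm.
by rewrite andbT plays_rcons Hq relayS.
Qed.

(** Preserves the invariant of honest play: all strategies consistent with the transcript stand at
    the same node of [T], the one where [X] stands. *)
Lemma cur_step ks d s s' q os m o : relay_node d.+1 q os -> (m < D.+1)%N -> (o < D.+1)%N ->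
  (forall e, valid_choice T e -> plays cipher_tree (encrypt e ks) q -> cur e os = s) ->
  (forall e, valid_choice T e -> reached e s -> decode ks os m = message e s ->
     observe (act e s) o = s') ->
  forall e, valid_choice T e -> plays cipher_tree (encrypt e ks) (rcons (rcons q m) o) ->
    cur e (rcons os o) = s'.
Proof.
move=> Hn Hm Ho HJ Hs' e He; have [H1 H2 H3 /andP[H4 H5] H6] := Hn.
rewrite (plays_relay_rcons _ _ _ _ _ _ H1 Hm Ho) => /andP[Hpl].
rewrite (encrypt_relay _ _ _ _ _ _ He Hn Hm) cur_rcons // (HJ _ He Hpl) => /eqP Hd.
by apply: Hs' => //; rewrite -(HJ _ He Hpl); exact: reached_cur.
Qed.

Lemma inhabited_relay_dual d : inhabited_tree (dual (relay d)).
Proof. by have /andP[/tree_form_inhabited/inhabited_dual] := tree_form_relay d. Qed.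

Lemma dual_relayS d :
  dual (relay d.+1) = Obs (nseq D.+1 (Dec (nseq D.+1 (dual (relay d))))).
Proof. by rewrite relayS /= !map_nseq /= !map_nseq. Qed.

(** Size is the budget: each round descends in [T] until a leaf is reached, so [tsize s.1 <= d.+1]
    makes [s] a leaf once the relay has ended. In a round the player reads the relay's answer, plays
    its decoding in [X], lets [X] observe and reports the observation. *)
Lemma win_relay ks d s q os :
  relay_node d q os -> tree_form s.1 -> ~~ is_obs s.1 -> (Defs.tsize s.1 <= d.+1)%N ->
  (forall e, valid_choice T e -> plays cipher_tree (encrypt e ks) q -> cur e os = s) ->
  win_state recovers
    ((s :: [seq share_state ks j | j <- enum 'I_k]) ++ [:: (dual (relay d), q)]).
Proof.
set sh := map _ _.
have Hshl : all (fun s => is_leaf s.1) sh by rewrite all_map; apply/allP.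
have Hsho : ~~ has (fun s => is_obs s.1) sh.
  by apply/hasPn => x /(allP Hshl); case: (x.1).
have Hshi : all (fun s => inhabited_tree s.1) sh.
  by apply: sub_all Hshl => -[[]].
elim: d s q os => [|d IH] s q os Hn Htf Hno Hsz HJ.
  have Hsl : is_leaf s.1.
    move: (tree_form_inhabited _ _ Htf) Hsz.
    by case: (s.1) => // -[//|c cs] _ /=; have := tsize_gt0 _ c; case: (Defs.tsize c).
  apply: win_state_leaf; first by rewrite all_cat /= Hsl Hshl.
  move=> e ks' He /=; rewrite map_cat all_cat /= andbT => /andP[Hks Hq].
  (* The share leaves are compatible with one key only, so the hypothesis on [ks] covers [ks']. *)
  have E : ks' = ks.
    apply/ffunP => j; apply: enum_rank_inj; apply: val_inj; apply/eqP.
    rewrite -(plays_cipher_share (key_sum ks' + plain e)).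
    move/allP: Hks; apply; rewrite /sh -map_comp.
    by apply/mapP; exists j; rewrite ?mem_enum.
  by rewrite -(HJ e He) -?E //; have [] := reached_cur e os He.
have Hcur : ~~ has (fun s => is_obs s.1) ((s :: sh) ++ [::]).
  by rewrite cats0 /= negb_or Hno.
apply: win_state_obs => //.
move=> s1 /kidsP[m]; rewrite dual_relayS children_obs size_nseq => Hm ->.
rewrite nth_nseq Hm [_.2]/=.
set E1 := (_, rcons q m).
have Hsend s' o : (o < D.+1)%N -> tree_form s'.1 -> ~~ is_obs s'.1 ->
    (Defs.tsize s'.1 <= d.+1)%N ->
    (forall e, valid_choice T e -> reached e s -> decode ks os m = message e s ->
       observe (act e s) o = s') ->
    win_state recovers ((s' :: sh) ++ [:: E1]).
  move=> Ho Htf' Hno' Hsz' Hs'.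
  apply: (win_state_dec _ _ _ _ (dual (relay d), rcons (rcons q m) o)).
  - rewrite cat_cons /= all_cat Hshi (tree_form_inhabited _ _ Htf') /=.
    by rewrite inhabited_relay_dual /= all_nseq inhabited_relay_dual orbT.
  - by rewrite cat_cons /= has_cat !negb_or Hno' Hsho.
  - have := mem_kids E1 o; rewrite children_dec size_nseq nth_nseq Ho; exact.
  - apply: IH Htf' Hno' Hsz' _; first exact: relay_node_rcons Hn Hm Ho.
    exact: cur_step Hn Hm Ho HJ Hs'.
(* A node that neither observes nor decides is a leaf; 0 is then reported as a dummy observation. *)
case Hd : (is_dec s.1); last first.
  apply: (Hsend s 0%N) => //.
    by case: (s.1) Hno Hd.
  by move=> e He _ _; rewrite /act Hd /observe (negbTE Hno).
have Hne : (0 < size (children s.1))%N.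
  by apply: children_gt0; [exact: tree_form_inhabited | case: (s.1) Hd].
(* On transcripts that no encryption produces the decoded value may exceed the arity, and a legal
   move is still required. *)
set a := clamp (size (children s.1)) (decode ks os m).
have Ha : (a < size (children s.1))%N := clamp_lt _ _ Hne.
set c : tree * seq nat := (nth_tree (children s.1) a, rcons s.2 a).
have Hc : c \in kids s := mem_kids _ _ Ha.
have Hctf : tree_form c.1 := tree_form_child _ _ _ Htf Ha.
have Hcsz : (Defs.tsize c.1 <= d.+1)%N.
  by rewrite -ltnS; apply: leq_trans Hsz; exact: ltn_tsize_child.
have Hact e : valid_choice T e -> reached e s -> decode ks os m = message e s -> act e s = c.
  move=> He [Hs _]; rewrite /message /act /c /a Hd => ->.
  have Hi : (e s.2 < size (children s.1))%N by case: (s.1) Hd Hs => // cs _ /He.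
  by rewrite /clamp Hi.
have E1i : inhabited_tree E1.1.
  by rewrite /= inhabited_relay_dual /= all_nseq inhabited_relay_dual orbT.
apply: (win_state_dec _ [::] s (sh ++ [:: E1]) c) => //.
- by rewrite cat0s -cat1s !all_cat !all_seq1 Hshi E1i (tree_form_inhabited _ _ Htf).
- by rewrite /= has_cat !negb_or Hno Hsho.
case Hco : (is_obs c.1); last first.
  apply: (Hsend c 0%N) => //; first by rewrite Hco.
  by move=> e He Hr Hde; rewrite Hact // /observe Hco.
apply: (win_state_obs _ [::] c (sh ++ [:: E1])) => //.
  by rewrite /= has_cat !negb_or Hsho.
move=> s' /kidsP[o Ho ->].
have HoD : (o < D.+1)%N.
  apply: leq_trans Ho _; apply: leq_trans (ltnW (size_children_tsize _ _)) _.
  apply: leq_trans Hcsz _; have [_ _ _ /andP[_ /eqP <-] _] := Hn.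
  exact: leq_addl.
apply: (Hsend _ o) => //.
- exact: tree_form_child.
- by move: Hctf Ho; case: (c.1) Hco => // cs _; exact: tree_form_obs_child.
- by apply/ltnW/(leq_trans _ Hcsz)/ltn_tsize_child.
- by move=> e He Hr Hde; rewrite Hact // /observe Hco /= /clamp Ho.
Qed.

(** No key is known while shares are still being queried, so the leaves reached are recorded by raw
    values; a complete list is then turned into a key. *)
Definition share_states (sh : seq nat) : seq (tree * seq nat) :=
  [seq (Leaf tt, [:: (D.+1 + p.1)%N; p.2]) | p <- zip (iota 0 (size sh)) sh].

Lemma share_states_rcons sh v :
  share_states (rcons sh v) = rcons (share_states sh) (Leaf tt, [:: (D.+1 + size sh)%N; v]).
Proof.
rewrite /share_states size_rcons -[(size sh).+1]addn1 iotaD cats1 zip_rcons ?size_iota // map_rcons.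
by [].
Qed.

Lemma share_states_leaf sh : all (fun s => is_leaf s.1) (share_states sh).
Proof. by rewrite all_map; apply/allP. Qed.

Lemma share_statesE sh : size sh = k -> all (fun v => v < #|{: pad}|)%N sh ->
  exists ks : key, share_states sh = [seq share_state ks j | j <- enum 'I_k].
Proof.
move=> Hs Ha.
have P : (0 < #|{: pad}|)%N by apply/card_gt0P; exists 0.
pose v0 : 'I_#|{: pad}| := Ordinal P.
exists [ffun j : 'I_k => enum_val (insubd v0 (nth 0%N sh j))].
apply: (@eq_from_nth _ st0) => [|i].
  by rewrite [RHS]size_map size_enum_ord [LHS]size_map size_zip size_iota minnn.
rewrite size_map size_zip size_iota minnn Hs => Hi.
rewrite (nth_map (0%N, 0%N)) ?size_zip ?size_iota ?minnn ?Hs //.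
rewrite nth_zip ?size_iota // nth_iota ?Hs // add0n.
rewrite (nth_map (Ordinal Hi)) ?size_enum_ord // /share_state nth_enum_ord //.
rewrite ffunE enum_valK nth_enum_ord //= insubdK //.
by apply: (allP Ha); rewrite mem_nth ?Hs.
Qed.

Lemma dual_cipher_tree : dual cipher_tree =
  Dec (nseq D.+1 (dual (relay D)) ++ nseq k (Obs (nseq #|{: pad}| (Leaf tt)))).
Proof. by rewrite /cipher_tree [dual _]/= map_cat !map_nseq /= map_nseq. Qed.

Lemma inhabited_dual_cipher : inhabited_tree (dual cipher_tree).
Proof. exact/inhabited_dual/inhabited_cipher_tree. Qed.

(** [r] shares remain and [r.+1] mediators are at their root, the last being kept for the relay. The
    first observation [o] of [X] is already made, so share replies are the only moves of the
    environment. *)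
Lemma win_shares r s o sh : (o < D.+1)%N -> tree_form s.1 -> ~~ is_obs s.1 ->
  (Defs.tsize s.1 <= D.+1)%N ->
  (forall e, valid_choice T e -> cur e [:: o] = s) ->
  (size sh + r)%N = k -> all (fun v => v < #|{: pad}|)%N sh ->
  win_state recovers ((s :: share_states sh) ++ nseq r.+1 (dual cipher_tree, [::])).
Proof.
move=> Ho Htf Hno Hsz HJ.
have Hinh m sh' :
    all (fun s => inhabited_tree s.1) ((s :: share_states sh') ++ nseq m (dual cipher_tree, [::])).
  rewrite all_cat all_nseq; apply/andP; split; last by rewrite inhabited_dual_cipher orbT.
  apply/andP; split; first exact: tree_form_inhabited.
  by apply: sub_all (share_states_leaf sh') => -[[]].
have Hobs m sh' :
    ~~ has (fun s => is_obs s.1) ((s :: share_states sh') ++ nseq m (dual cipher_tree, [::])).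
  rewrite has_cat negb_or; apply/andP; split; last by rewrite has_nseq; case: (0 < m)%N.
  rewrite [has _ _]/= negb_or Hno; apply/hasPn => x /(allP (share_states_leaf sh')).
  by case: (x.1).
elim: r sh => [|r IH] sh Hr Hsh.
  rewrite addn0 in Hr; have [ks E] := share_statesE _ Hr Hsh.
  apply: (win_state_dec _ _ _ _ (dual (relay D), [:: o]) (Hinh 1%N sh) (Hobs 1%N sh)).
    have := mem_kids (dual cipher_tree, [::]) o.
    rewrite dual_cipher_tree children_dec size_cat !size_nseq nth_cat size_nseq Ho nth_nseq Ho.
    by apply; rewrite ltn_addr.
  rewrite E; apply: win_relay (relay_node_head _ Ho) Htf Hno Hsz _.
  by move=> e He _; exact: HJ.
have Hsk : (size sh < k)%N by rewrite -Hr addnS ltnS leq_addr.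
apply: (win_state_dec _ _ _ _ (Obs (nseq #|{: pad}| (Leaf tt)), [:: (D.+1 + size sh)%N])
         (Hinh r.+2 sh) (Hobs r.+2 sh)).
  have := mem_kids (dual cipher_tree, [::]) (D.+1 + size sh)%N.
  rewrite dual_cipher_tree children_dec size_cat !size_nseq nth_cat size_nseq.
  by rewrite [X in if X then _ else _]ltnNge leq_addr [~~ true]/= addKn nth_nseq Hsk ltn_add2l; apply.
apply: win_state_obs; [by [] | exact: (Hobs r.+1 sh) | ].
move=> s' /kidsP[v]; rewrite children_obs size_nseq => Hv ->; rewrite nth_nseq Hv.
have := IH (rcons sh v); rewrite share_states_rcons size_rcons all_rcons Hv Hsh addSnnS Hr.
by rewrite -cats1 -cat_cons -catA; apply.
Qed.

Lemma win_honest : win recovers (interleave T cipher_tree k.+1).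
Proof.
have Hinit : win_state recovers ((T, [::]) :: nseq k.+1 (dual cipher_tree, [::])).
  (* If [T] does not start with an observation, a dummy 0 opens the relay and [observe] ignores
     it. *)
  case Ho : (is_obs T); last first.
    have := win_shares k (T, [::]) 0%N [::]; apply=> //; first by rewrite Ho.
    by move=> e He; rewrite /cur /= /observe Ho.
  apply: (win_state_obs _ [::]) => //.
    by rewrite cat0s has_nseq; case: (0 < k.+1)%N.
  move=> s /kidsP[o Hos ->].
  have HoD : (o < D.+1)%N.
    by apply: leq_trans Hos _; apply: leq_trans (ltnW (size_children_tsize _ _)) HTD.
  have := win_shares k (nth_tree (children T) o, [:: o]) o [::]; apply=> //.
  - exact: tree_form_child.
  - by move: HT Hos; case: (T) Ho => // cs _; exact: tree_form_obs_child.
  - by apply/ltnW/(leq_trans _ HTD)/ltn_tsize_child.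
  - by move=> e He; rewrite /cur /= /observe Ho /= /clamp Hos.
have E : [seq (t, [::] : seq nat) | t <- T :: nseq k.+1 (dual cipher_tree)] =
    (T, [::]) :: nseq k.+1 (dual cipher_tree, [::]) by rewrite map_cons map_nseq.
have := state_size_init T cipher_tree k.+1; rewrite -/(interleave _ _ _) E => Hs.
by have := Hinit _ Hs; rewrite -E.
Qed.

Section Moments.
Variable R : realType.

(** Safety only shows that the decrypted strategy plays no leaf outside those of [e];
    [plays_antichain] turns the inclusion into equality. The mediator strategy is pure, so even a
    [y] that encrypts nothing has a pure image. *)
Lemma honest_mediator : exists q : {ffun TS T cipher_tree k.+1 -> R},
  [/\ reduced T cipher_tree k.+1 q,
      forall y, is_pure cipher_tree y -> exists x : {ffun Z T -> bool},
        is_pure T x /\ med T cipher_tree k.+1 q (vR cipher_tree y) = vR T x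
    & forall e ks, valid_choice T e ->
        med T cipher_tree k.+1 q (vR cipher_tree (pure_vec cipher_tree (encrypt e ks)))
        = vR T (pure_vec T e)].
Proof.
have [c Hc Hwin] := win_honest.
exists (pure_reduced T cipher_tree k.+1 c); split; first exact: reduced_pure.
- move=> y [d [Hd ->]]; have [e He [-> _]] := med_pure_reduced R _ _ _ _ _ (inhabited_player) Hc Hd.
  by exists (pure_vec T e); split=> //; exists e.
move=> e ks He.
have [e' He' [-> H]] := med_pure_reduced R _ _ _ _ _ (inhabited_player) Hc
  (valid_cipher (key_sum ks + plain e) ks).
have Hle x : x \in leaves T -> plays T e' x.1 -> plays T e x.1.
  move=> Hx /(H _ Hx) [l Hl /andP[Hpl /andP[/eqP <- Hall]]].
  exact: Hwin Hl Hpl e ks He Hall.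
congr (vR T _); apply/ffunP => z; rewrite !ffunE; have Hz := addr_leaves _ _ z.
apply/idP/idP; first exact: (Hle _ Hz).
exact: (plays_antichain _ _ _ _ inhabited_player He' He Hle _ Hz).
Qed.

(** * Linearity of the averaged query outcomes *)

(** The coefficients are independent of [e], so [F] is a linear functional of the pure vector,
    whatever choice represents it. *)
Definition linear_in_plays (F : (seq nat -> nat) -> R) : Prop :=
  exists a : Z T -> R, forall e, valid_choice T e ->
    F e = \sum_z a z * (plays T e (addr T z))%:R.

Lemma linear_ext F G : (forall e, valid_choice T e -> F e = G e) ->
  linear_in_plays G -> linear_in_plays F.
Proof. by move=> H [a Ha]; exists a => e He; rewrite H // Ha. Qed.

Lemma linear_scale (c : R) F : linear_in_plays F -> linear_in_plays (fun e => c * F e).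
Proof.
move=> [a Ha]; exists (fun z => c * a z) => e He; rewrite Ha // mulr_sumr.
by apply: eq_bigr => z _; rewrite mulrA.
Qed.

Lemma linear0 : linear_in_plays (fun=> 0).
Proof. by exists (fun=> 0) => e _; rewrite big1 // => z _; rewrite mul0r. Qed.

Lemma linear_sum (I : finType) F : (forall i : I, linear_in_plays (F i)) ->
  linear_in_plays (fun e => \sum_i F i e).
Proof.
move=> /choice[a Ha]; exists (fun z => \sum_i a i z) => e He.
under eq_bigr => i _ do rewrite (Ha i e He).
by rewrite exchange_big; apply: eq_bigr => z _; rewrite mulr_suml.
Qed.

(** Flow conservation: at a decision point the indicator of a path is the sum over all children, at
    an observation point it equals that of any one child. *)
Lemma linear_plays p u : subtree p T = Some u ->
  linear_in_plays (fun e => (plays T e p)%:R).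
Proof.
elim/gtree_nth_ind: u p => [l|cs IH|cs IH] p Hp.
- have /leaves_addr[z [/= Hz _]] := subtree_leaf _ _ _ _ Hp.
  exists (fun z' => (z' == z)%:R) => e _.
  rewrite (bigD1 z) //= eqxx mul1r Hz big1 ?addr0 // => z' /negbTE ->.
  by rewrite mul0r.
- apply: (linear_ext _ (fun e => \sum_(i < size cs) (plays T e (rcons p i))%:R)).
    move=> e He; have Hi := He _ _ Hp; rewrite (bigD1 (Ordinal Hi)) //= plays_rcons Hp eqxx andbT.
    rewrite big1 ?addr0 // => i Hne; rewrite plays_rcons Hp.
    by rewrite eq_sym -[_ == e p]/(i == Ordinal Hi) (negbTE Hne) andbF.
  by apply: linear_sum => i; apply: (IH i) => //; rewrite (subtree_rcons _ _ _ _ _ Hp).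
- have Hi : (0 < size cs)%N.
    exact: children_gt0 (inhabited_subtree _ _ _ _ inhabited_player Hp) isT.
  apply: (linear_ext _ (fun e => (plays T e (rcons p 0%N))%:R)).
    by move=> e He; rewrite plays_rcons Hp andbT.
  by apply: (IH 0%N) => //; rewrite (subtree_rcons _ _ _ _ _ Hp).
Qed.

(** The empty path is always played, so on pure strategies affine functions are already linear. *)
Lemma linear_const (c : R) : linear_in_plays (fun=> c).
Proof.
apply: (linear_ext _ (fun e => c * (plays T e [::])%:R)) => [e _|].
  by rewrite plays_nil mulr1.
exact/linear_scale/(linear_plays _ T).
Qed.

Lemma leaves_relayS d x : x \in leaves (relay d.+1) -> exists m o r,
  [/\ (m < D.+1)%N, (o < D.+1)%N, x.1 = m :: o :: r & (r, tt) \in leaves (relay d)].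
Proof.
rewrite relayS => /leaves_nodeP [//|m [p []]]; rewrite children_dec size_nseq => Hm ->.
rewrite nth_nseq Hm => /leaves_nodeP [//|o [r []]]; rewrite children_obs size_nseq => Ho; rewrite [(_, _).1]/= => ->.
by rewrite nth_nseq Ho; case: (x.2) => Hr; exists m, o, r.
Qed.

Lemma subtree_observe s o : subtree s.2 T = Some s.1 ->
  subtree (observe s o).2 T = Some (observe s o).1.
Proof.
move=> Hs; rewrite /observe; case Ho : (is_obs s.1) => //.
apply: subtree_rcons => //; apply: clamp_lt.
by apply: children_gt0; [exact: inhabited_subtree inhabited_player Hs | case: (s.1) Ho].
Qed.

Lemma plays_observe e s o : subtree s.2 T = Some s.1 ->
  plays T e (observe s o).2 = plays T e s.2.
Proof.
move=> Hs; rewrite /observe; case Ho : (is_obs s.1) => //=.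
by rewrite plays_rcons Hs; case: (s.1) Ho => // cs _; rewrite andbT.
Qed.

(** Under a fixed key the answers written in a relay path decode to actions. The strategies that
    send them are either none or exactly those playing one path of [T], and [s] tracks the end of
    that path. *)
Lemma linear_relay ks d r s q os :
  relay_node d q os -> subtree s.2 T = Some s.1 -> (r, tt) \in leaves (relay d) ->
  (forall e, valid_choice T e -> plays T e s.2 ->
     cur e os = s /\ plays cipher_tree (encrypt e ks) q) ->
  linear_in_plays (fun e =>
     (plays T e s.2 && plays cipher_tree (encrypt e ks) (q ++ r))%:R).
Proof.
elim: d r s q os => [|d IH] r s q os Hn Hs Hr HJ.
  move: Hr; rewrite inE => /eqP[->]; apply: linear_ext (linear_plays _ _ Hs) => e He.
  by rewrite cats0; case: (boolP (plays T e s.2)) => // /(HJ e He) [_ ->].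
have [m [o [r' [Hm Ho /= -> Hr']]]] := leaves_relayS _ _ Hr; rewrite -!cat_rcons.
have [H1 H2 H3 /andP[H4 H5] H6] := Hn.
have Hq e : plays cipher_tree (encrypt e ks) (rcons (rcons q m) o ++ r') ->
    encrypt e ks q == m.
  by move=> /plays_cat; rewrite (plays_relay_rcons _ _ _ _ _ _ H1 Hm Ho) => /andP[].
have Henc e : valid_choice T e -> plays T e s.2 ->
    (encrypt e ks q == m) = (decode ks os m == message e s).
  by move=> He /(HJ e He) [E _]; rewrite (encrypt_relay _ _ _ _ _ _ He Hn Hm) E.
have step s' : subtree s'.2 T = Some s'.1 ->
    (forall e, valid_choice T e ->
       plays T e s'.2 = plays T e s.2 && (decode ks os m == message e s)) ->
    (forall e, valid_choice T e -> plays T e s'.2 -> observe (act e s) o = s') ->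
    linear_in_plays (fun e => (plays T e s.2 &&
        plays cipher_tree (encrypt e ks) (rcons (rcons q m) o ++ r'))%:R).
  move=> Hs' Hpl Hcur.
  apply: (linear_ext _ (fun e => (plays T e s'.2 &&
        plays cipher_tree (encrypt e ks) (rcons (rcons q m) o ++ r'))%:R)) => [e He|].
    rewrite Hpl //; congr (nat_of_bool _)%:R; case Hp : (plays T e s.2) => //=.
    rewrite -Henc // andbC; apply/idP/andP => [H|[]//].
    by split=> //; exact: Hq.
  apply: IH Hs' Hr' _; first exact: relay_node_rcons Hn Hm Ho.
  move=> e He Hp'; have := Hp'; rewrite Hpl // => /andP[Hp Hdec].
  have [E Hpq] := HJ e He Hp; split; first by rewrite cur_rcons // E; exact: Hcur.
  by rewrite (plays_relay_rcons _ _ _ _ _ _ H1 Hm Ho) Hpq Henc.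
have zero : (forall e, valid_choice T e -> plays T e s.2 ->
       decode ks os m != message e s) ->
    linear_in_plays (fun e => (plays T e s.2 &&
        plays cipher_tree (encrypt e ks) (rcons (rcons q m) o ++ r'))%:R).
  move=> Hne; apply: linear_ext linear0 => e He.
  case: (boolP (plays T e s.2)) => //= Hp; case: (boolP (plays _ _ _)) => // /Hq.
  by rewrite Henc // (negbTE (Hne e He Hp)).
(* Away from decision points the only message is the dummy 0; any other decoded value makes the
   event empty. *)
case Hd : (is_dec s.1); last first.
  case: (eqVneq (decode ks os m) 0%N) => Hdec; last first.
    by apply: zero => e _ _; rewrite /message Hd.
  apply: (step (observe s o)); first exact: subtree_observe.
    by move=> e He; rewrite plays_observe // /message Hd Hdec eqxx andbT.
  by move=> e He _; rewrite /act Hd.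
(* A decoded value beyond the arity is no action, so no strategy sends it. *)
case: (ltnP (decode ks os m) (size (children s.1))) => Hdec; last first.
  apply: zero => e He _; rewrite /message Hd gtn_eqF //; apply: leq_trans Hdec.
  by case: (s.1) Hd Hs => // cs _ /He.
set b := decode ks os m in Hdec *.
pose s1 : tree * seq nat := (nth_tree (children s.1) b, rcons s.2 b).
have Hs1 : subtree s1.2 T = Some s1.1 by exact: subtree_rcons.
have Hps1 e : plays T e s1.2 = plays T e s.2 && (b == message e s).
  by rewrite /s1 plays_rcons Hs /message Hd; case: (s.1) Hd => // cs _; rewrite eq_sym.
apply: (step (observe s1 o)); first exact: subtree_observe.
  by move=> e He; rewrite plays_observe // Hps1.
move=> e He; rewrite plays_observe // Hps1 /message Hd => /andP[_ /eqP Eb].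
by rewrite /act Hd -Eb.
Qed.

Lemma cipher_leafP (z : Z cipher_tree) :
  (exists o r, [/\ (o < D.+1)%N, addr cipher_tree z = o :: r & (r, tt) \in leaves (relay D)]) \/
  (exists (j : 'I_k) v, addr cipher_tree z = [:: (D.+1 + j)%N; v]).
Proof.
have /leaves_nodeP [//|i [p []]] := addr_leaves _ _ z.
rewrite children_obs [(_, _).1]/= [(_, _).2]/=.
rewrite size_cat !size_nseq nth_cat size_nseq.
case: (ltnP i D.+1) => [Hi|Hi] Hi2 ->.
  by rewrite nth_nseq Hi; case: (label _ _) => Hp; left; exists i, p.
have Hik : (i - D.+1 < k)%N by rewrite ltn_subLR.
rewrite nth_nseq Hik => /leaves_nodeP [//|v [p' []]]; rewrite children_dec size_nseq => Hv; rewrite [(_, _).1]/= => ->.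
rewrite nth_nseq Hv inE => /eqP[-> _]; right; exists (Ordinal Hik), v.
by rewrite /= subnKC.
Qed.

Definition is_relay_leaf (z : Z cipher_tree) : bool :=
  (head 0%N (addr cipher_tree z) < D.+1)%N.

Lemma plays_share_const w w' ks z : ~~ is_relay_leaf z ->
  plays cipher_tree (cipher w ks) (addr cipher_tree z) =
  plays cipher_tree (cipher w' ks) (addr cipher_tree z).
Proof.
rewrite /is_relay_leaf; case: (cipher_leafP z) => [[o [r [Ho -> _]]]|[j [v ->]] _].
  by rewrite /= Ho.
by rewrite !plays_cipher_share.
Qed.

Lemma linear_relay_leaf ks z : is_relay_leaf z ->
  linear_in_plays (fun e => (plays cipher_tree (encrypt e ks) (addr cipher_tree z))%:R).
Proof.
rewrite /is_relay_leaf; case: (cipher_leafP z) => [[o [r [Ho -> Hr]]] _|[j [v ->]]]; last first.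
  by rewrite /= ltnNge leq_addr.
have H0 : subtree (observe (T, [::]) o).2 T = Some (observe (T, [::]) o).1.
  exact: subtree_observe.
have Hpl e : plays T e (observe (T, [::]) o).2 by rewrite plays_observe.
apply: linear_ext (linear_relay ks D r (observe (T, [::]) o) [:: o] [:: o]
   (relay_node_head _ Ho) H0 Hr _) => [e He|e He _]; first by rewrite Hpl.
by split=> //; rewrite -[[:: o]]/(rcons [::] o) plays_rcons.
Qed.

(** With [ks] fixed, share leaves do not depend on [e], so at most one factor varies; the pad 0 in
    the constant factors is a placeholder. *)
Lemma linear_moment_one ks (zs : {ffun 'I_k.+1 -> Z cipher_tree}) :
  (forall i i', is_relay_leaf (zs i) -> is_relay_leaf (zs i') -> i = i') ->
  linear_in_plays (fun e =>
    \prod_(i < k.+1) (plays cipher_tree (encrypt e ks) (addr cipher_tree (zs i)))%:R).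
Proof.
move=> H1; case: (pickP (fun i => is_relay_leaf (zs i))) => [i0 Hi0|Hno].
  have Hne i : i != i0 -> ~~ is_relay_leaf (zs i).
    by move=> Hi; apply: contra Hi => Hr; apply/eqP; exact: H1.
  apply: (linear_ext _ (fun e => (\prod_(i < k.+1 | i != i0)
      (plays cipher_tree (cipher 0 ks) (addr cipher_tree (zs i)))%:R) *
      (plays cipher_tree (encrypt e ks) (addr cipher_tree (zs i0)))%:R)) => [e He|].
    rewrite (bigD1 i0) //= mulrC; congr (_ * _); apply: eq_bigr => i /Hne Hi.
    by rewrite (plays_share_const _ 0).
  exact/linear_scale/linear_relay_leaf.
apply: linear_ext (linear_const (\prod_(i < k.+1)
  (plays cipher_tree (cipher 0 ks) (addr cipher_tree (zs i)))%:R)) => e He.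
by apply: eq_bigr => i _; rewrite (plays_share_const _ 0) // Hno.
Qed.

Lemma plays_cipher_share_ext w (ks ks' : key) z (j0 : 'I_k) :
  head 0%N (addr cipher_tree z) != (D.+1 + j0)%N -> (forall j, j != j0 -> ks j = ks' j) ->
  plays cipher_tree (cipher w ks) (addr cipher_tree z) =
  plays cipher_tree (cipher w ks') (addr cipher_tree z).
Proof.
case: (cipher_leafP z) => [[o [r [Ho -> _]]] _ _|[j [v ->]]].
  exact: plays_cipher_relay.
by rewrite /= eqn_add2l => Hj Hks; rewrite !plays_cipher_share Hks.
Qed.

(* A missing share makes the sum of all shares an unknown uniform pad: shifting that share by
   [- plain e] removes the dependence on [e]. *)
Lemma moment_missing_share (zs : {ffun 'I_k.+1 -> Z cipher_tree}) (j0 : 'I_k) e :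
  (forall i, head 0%N (addr cipher_tree (zs i)) != (D.+1 + j0)%N) ->
  \sum_(ks : key) \prod_(i < k.+1)
     (plays cipher_tree (encrypt e ks) (addr cipher_tree (zs i)))%:R =
  \sum_(ks : key) \prod_(i < k.+1)
     (plays cipher_tree (cipher (key_sum ks) ks) (addr cipher_tree (zs i)))%:R :> R.
Proof.
move=> Hj0; pose sft : key := [ffun j => if j == j0 then - plain e else 0].
rewrite (reindex_inj (addIr sft)) /=; apply: eq_bigr => ks _; apply: eq_bigr => i _.
rewrite /encrypt.
have -> : key_sum (ks + sft) + plain e = key_sum ks.
  rewrite /key_sum; under eq_bigr => j _ do rewrite ffunE.
  rewrite big_split /= [X in _ + X + _](bigD1 j0) //= [X in _ + (_ + X) + _]big1 => [|j /negbTE Hj].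
    by rewrite ffunE eqxx addr0 subrK.
  by rewrite ffunE Hj.
congr (nat_of_bool _)%:R; apply: (plays_cipher_share_ext _ _ _ _ j0 (Hj0 i)) => j /negbTE Hj.
by rewrite !ffunE Hj addr0.
Qed.

(** Pigeonhole: if all [k] shares were queried, then together with [i1] and [i2] there would be
    [k + 2] distinct queries. *)
Lemma missing_share (zs : {ffun 'I_k.+1 -> Z cipher_tree}) (i1 i2 : 'I_k.+1) :
  i1 != i2 -> is_relay_leaf (zs i1) -> is_relay_leaf (zs i2) ->
  exists j0 : 'I_k, forall i, head 0%N (addr cipher_tree (zs i)) != (D.+1 + j0)%N.
Proof.
move=> Hne H1 H2.
case: (boolP [exists j0 : 'I_k, [forall i, head 0%N (addr cipher_tree (zs i)) != (D.+1 + j0)%N]]).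
  by case/existsP => j0 /forallP H; exists j0.
rewrite negb_exists => /forallP H.
have /choice[g Hg] : forall j : 'I_k, exists i, head 0%N (addr cipher_tree (zs i)) = (D.+1 + j)%N.
  by move=> j; have := H j; rewrite negb_forall => /existsP[i]; rewrite negbK => /eqP Hi; exists i.
have Hinj : injective g.
  by move=> j j' E; have := Hg j; rewrite E Hg => /addnI/val_inj.
have Hd j i : is_relay_leaf (zs i) -> g j != i.
  by move=> Hi; apply: contraTneq Hi => <-; rewrite /is_relay_leaf Hg ltnNge leq_addr.
have : (#|[set i1; i2] :|: [set g j | j in 'I_k]| <= #|'I_k.+1|)%N by exact: max_card.
rewrite cardsU (_ : _ :&: _ = set0); last first.
  apply/setP => i; rewrite !inE; apply/negbTE/negP => /andP[Hi /imsetP[j _ E]].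
  by case/orP: Hi => /eqP Ei; [have := Hd j i1 H1 | have := Hd j i2 H2]; rewrite -E Ei eqxx.
by rewrite cards0 subn0 card_imset // cards2 Hne !card_ord addSn ltnn.
Qed.

(** With two relay leaves only the sum over keys is controlled, and it is constant in [e]; otherwise
    each key contributes a linear term by itself. *)
Lemma linear_moment (zs : {ffun 'I_k.+1 -> Z cipher_tree}) :
  linear_in_plays (fun e => \sum_(ks : key) \prod_(i < k.+1)
     (plays cipher_tree (encrypt e ks) (addr cipher_tree (zs i)))%:R).
Proof.
case: (boolP [exists i1, [exists i2, [&& i1 != i2, is_relay_leaf (zs i1) & is_relay_leaf (zs i2)]]]).
  case/existsP => i1 /existsP[i2 /and3P[Hne H1 H2]].
  have [j0 Hj0] := missing_share _ _ _ Hne H1 H2.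
  by apply: linear_ext (linear_const _) => e He; rewrite (moment_missing_share _ j0).
rewrite negb_exists => /forallP H; apply: linear_sum => ks; apply: linear_moment_one => i i' Hi Hi'.
apply/eqP; have := H i; rewrite negb_exists => /forallP/(_ i'); rewrite Hi Hi' !andbT negbK.
exact.
Qed.

(** Each coordinate of [med] combines moments with coefficients from [q]; the functionals found for
    the coordinates are the rows of [A]. *)
Lemma linear_mediator (q : {ffun TS T cipher_tree k.+1 -> R}) : exists A : Z T -> Z T -> R,
  forall e, valid_choice T e -> forall z,
  #|{: key}|%:R^-1 * (\sum_(ks : key)
    med T cipher_tree k.+1 q (vR cipher_tree (pure_vec cipher_tree (encrypt e ks))) z)
  = linmap T A (vR T (pure_vec T e)) z.
Proof.
have /choice[A HA] : forall z, exists a : Z T -> R, forall e, valid_choice T e ->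
  #|{: key}|%:R^-1 * (\sum_(ks : key)
    med T cipher_tree k.+1 q (vR cipher_tree (pure_vec cipher_tree (encrypt e ks))) z)
  = \sum_z' a z' * (plays T e (addr T z'))%:R.
  move=> z.
  have L : linear_in_plays (fun e => #|{: key}|%:R^-1 * \sum_zs q (z, zs) *
     (\sum_(ks : key) \prod_(i < k.+1)
       (plays cipher_tree (encrypt e ks) (addr cipher_tree (zs i)))%:R)).
    by apply/linear_scale/linear_sum => zs; exact/linear_scale/linear_moment.
  apply: linear_ext L => e He; congr (_ * _).
  under eq_bigr => ks _ do rewrite ffunE.
  rewrite exchange_big /=; apply: eq_bigr => zs _; rewrite mulr_sumr.
  by apply: eq_bigr => ks _; congr (_ * _); apply: eq_bigr => i _; rewrite !ffunE.
exists A => e He z; rewrite HA // ffunE.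
by apply: eq_bigr => z' _; rewrite !ffunE.
Qed.

(** The averaged map is a uniform mixture of mediator images of pure strategies of [Y], each of
    which lies in the convex hull. *)
Lemma lin_swap_mediator (q : {ffun TS T cipher_tree k.+1 -> R}) (A : Z T -> Z T -> R) :
  reduced T cipher_tree k.+1 q ->
  (forall e, valid_choice T e -> forall z,
  #|{: key}|%:R^-1 * (\sum_(ks : key)
    med T cipher_tree k.+1 q (vR cipher_tree (pure_vec cipher_tree (encrypt e ks))) z)
  = linmap T A (vR T (pure_vec T e)) z) ->
  lin_swap T A.
Proof.
move=> Hq HA x [e [He ->]].
have Hcard : (#|{: key}|%:R : R) != 0.
  by rewrite pnatr_eq0 -lt0n; apply/card_gt0P; exists 0.
apply: (in_co_mix _ _ _ _ (fun ks : key => #|{: key}|%:R^-1) (fun ks =>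
   med T cipher_tree k.+1 q (vR cipher_tree (pure_vec cipher_tree (encrypt e ks))))).
- by move=> ks; rewrite invr_ge0 ler0n.
- by rewrite sumr_const -[LHS]mulr_natr mulVf.
- move=> ks _; apply: med_in_co (inhabited_player) Hq _.
  by exists (encrypt e ks); split=> //; exact: valid_cipher.
- by move=> z; rewrite -HA // mulr_sumr.
Qed.

End Moments.

End Player.
End Encryption.

(** * The encrypted profile and its equilibrium property *)

(** A pure vector leaves the choices at unreached nodes open, so a representative is fixed; the
    constant 0 makes encryption total. *)
Definition strategy_of (t : tree) (x : {ffun Z t -> bool}) : seq nat -> nat :=
  if pselect (is_pure t x) is left h then sval (cid h) else fun=> 0%N.

Lemma strategy_ofP t x : is_pure t x ->
  valid_choice t (strategy_of t x) /\ x = pure_vec t (strategy_of t x).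
Proof. by move=> h; rewrite /strategy_of; case: pselect => // h'; case: (cid h'). Qed.

Lemma vR_inj (R : realType) L (t : gtree L) : injective (@vR R L t).
Proof.
move=> x y /ffunP E; apply/ffunP => z; have := E z; rewrite !ffunE.
by case: (x z) (y z) => -[] // /eqP; rewrite ?oner_eq0 // eq_sym oner_eq0.
Qed.

(** A marginal of the uniform law on key tuples is uniform. Padding [F (w i)] with factors 1 for the
    other players lets the sum of products distribute. *)
Lemma ffun_average (R : realType) n (K : finType) (F : K -> R) (i : 'I_n) :
  (0 < #|K|)%N ->
  #|{ffun 'I_n -> K}|%:R^-1 * (\sum_(w : {ffun 'I_n -> K}) F (w i)) =
  #|K|%:R^-1 * \sum_k F k.
Proof.
move=> HK; have Hc : (#|K|%:R : R) != 0 by rewrite pnatr_eq0 -lt0n.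
have -> : \sum_(w : {ffun 'I_n -> K}) F (w i) =
    \sum_(w : {ffun 'I_n -> K}) \prod_j (if j == i then F (w j) else 1).
  apply: eq_bigr => w _; rewrite (bigD1 i) //= eqxx big1 ?mulr1 // => j /negbTE Hj.
  by rewrite Hj.
rewrite -(bigA_distr_bigA (fun j k => if j == i then F k else 1)) /=.
have -> : (#|{ffun 'I_n -> K}|%:R : R) = \prod_(j < n) #|K|%:R.
  by rewrite card_ffun natrX prodr_const.
rewrite (bigD1 i) //= [X in _ * X](bigD1 i) //= eqxx.
have -> : \prod_(j < n | j != i) \sum_(k : K) (if j == i then F k else 1)
    = \prod_(j < n | j != i) #|K|%:R.
  apply: eq_bigr => j /negbTE Hj; rewrite Hj; exact: sumr_const.
set P := \prod_(j | _) _; have HP : P != 0 by apply/prodf_neq0.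
by rewrite invfM mulrACA mulVf // mulr1.
Qed.

Section EncryptedProfile.
Variables (R : realType) (n k D : nat) (T : 'I_n -> tree) (pi : PX n T -> R).
Let Y := cipher_tree D k.
Let S := fun _ : 'I_n => Y.
Let Omega := {ffun 'I_n -> key D k}.

Definition encrypted_profile (x : PX n T) (w : Omega) : PX n S :=
  [ffun j => pure_vec Y (encrypt D k (T j) (strategy_of (T j) (x j)) (w j))].

(** Push-forward of [pi] times the uniform law on [Omega]: keys are independent across players and
    of the profile. *)
Definition encrypted_dist (y : PX n S) : R :=
  \sum_x \sum_(w : Omega) pi x * (#|{: Omega}|%:R^-1 * (y == encrypted_profile x w)%:R).

Lemma encrypted_dist_sum (H : PX n S -> R) :
  \sum_y encrypted_dist y * H y =
  \sum_x pi x * (#|{: Omega}|%:R^-1 * \sum_(w : Omega) H (encrypted_profile x w)).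
Proof.
under eq_bigr => y _ do rewrite mulr_suml.
rewrite exchange_big /=; apply: eq_bigr => x _.
under eq_bigr => y _ do rewrite mulr_suml.
rewrite exchange_big /= !mulr_sumr; apply: eq_bigr => w _.
rewrite (bigD1 (encrypted_profile x w)) //= eqxx mulr1 big1 ?addr0 ?mulrA // => y /negbTE ->.
by rewrite !mulr0 mul0r.
Qed.

Lemma card_Omega_neq0 : (#|{: Omega}|%:R : R) != 0.
Proof. by rewrite pnatr_eq0 -lt0n; apply/card_gt0P; exists [ffun=> 0 : key D k]. Qed.

Lemma average_const (c : R) : #|{: Omega}|%:R^-1 * (\sum_(w : Omega) c) = c.
Proof. by rewrite sumr_const -[c *+ _]mulr_natl mulrA mulVf ?mul1r ?card_Omega_neq0. Qed.

Lemma encrypted_profile_pure x w j : is_pure Y (encrypted_profile x w j).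
Proof.
rewrite ffunE; exists (encrypt D k (T j) (strategy_of (T j) (x j)) (w j)).
by split=> //; exact: valid_cipher.
Qed.

Lemma is_dist_encrypted : is_dist n T pi -> is_dist n S encrypted_dist.
Proof.
move=> [H0 H1 _]; split=> [y||y].
- apply: sumr_ge0 => x _; apply: sumr_ge0 => w _.
  by rewrite mulr_ge0 // mulr_ge0 // ?invr_ge0 ler0n.
- under eq_bigr => y _ do rewrite -[encrypted_dist y]mulr1.
  rewrite encrypted_dist_sum -[RHS]H1; apply: eq_bigr => x _.
  by rewrite average_const mulr1.
- move=> Hy; have : exists x w, y = encrypted_profile x w.
    apply: contraPP Hy => Hno; apply/negP; rewrite negbK; apply/eqP.
    apply: big1 => x _; apply: big1 => w _; case: eqP => [E|_]; last by rewrite !mulr0.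
    by case: Hno; exists x, w.
  by move=> [x [w ->]] j; exact: encrypted_profile_pure.
Qed.

End EncryptedProfile.

Theorem mainTheorem18 (R : realType) (n k : nat) (T : 'I_n -> tree)
  (U : 'I_n -> PZ n T -> R) (eps : R) (pi : PX n T -> R) :
  (1 <= k)%N -> 0 <= eps ->
  (forall i, tree_form (T i)) ->
  is_dist n T pi ->
  lin_swap_eq n T U eps pi ->
  exists (S : 'I_n -> tree) (q : forall i, {ffun TS (T i) (S i) k -> R})
         (pi' : PX n S -> R),
    [/\ forall i, tree_form (S i),
        forall i, reduced (T i) (S i) k (q i),
        forall i (y : {ffun Z (S i) -> bool}), is_pure (S i) y ->
          exists x : {ffun Z (T i) -> bool},
            is_pure (T i) x /\ med (T i) (S i) k (q i) (vR (S i) y) = vR (T i) x,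
        is_dist n S pi'
      & gen_eq n k T U eps S q pi' /\
        forall x : PX n T,
          pi x = \sum_(y : PX n S
                       | [forall j, med (T j) (S j) k (q j) (vR (S j) (y j)) == vR (T j) (x j)])
                   pi' y].
Proof.
(* From here on [k] counts the shares, one fewer than the mediators. *)
case: k => [//|k] _ _ HT Hpi Heq.
pose D := (\sum_i Defs.tsize (T i))%N.
have HD i : (Defs.tsize (T i) <= D.+1)%N.
  by apply: leqW; rewrite /D (bigD1 i) //=; exact: leq_addr.
pose Y := cipher_tree D k.
pose q i := sval (cid (honest_mediator D k (T i) (HT i) (HD i) R)).
have Hq i := svalP (cid (honest_mediator D k (T i) (HT i) (HD i) R)).
exists (fun=> Y), q, (encrypted_dist R n k D T pi).
have Hmed x w j : pi x != 0 ->
    med (T j) Y k.+1 (q j) (vR Y (encrypted_profile n k D T x w j)) = vR (T j) (x j).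
  case: Hpi => _ _ Hp /Hp /(_ j) /strategy_ofP [He E]; rewrite ffunE [in RHS]E.
  by have [_ _ ->] := Hq j.
split=> [i|i|i y Hy||].
- exact: tree_form_cipher_tree.
- by have [] := Hq i.
- by have [_ H _] := Hq i; exact: H.
- exact: is_dist_encrypted.
split=> [i q' Hq'|x].
- have [A HA] := linear_mediator D k (T i) (HT i) (HD i) R q'.
  have HAs := lin_swap_mediator D k (T i) (HT i) R q' A Hq' HA.
  rewrite !encrypted_dist_sum; apply: le_trans (le_trans (Heq i A HAs) _).
  + rewrite le_eqVlt; apply/orP; left; apply/eqP; apply: eq_bigr => x _.
    case: (eqVneq (pi x) 0) => [->|Hx]; first by rewrite !mul0r.
    congr (_ * _); rewrite /util_dev.
    (* The other players decrypt to [x j] whatever their keys, so the keys enter only through the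
       deviator's factor, in which the utility is linear. *)
    under eq_bigr => w _ do under eq_bigr => z _ do
      under eq_bigr => j _ do rewrite Hmed //.
    have HL zi : linmap (T i) A (vR (T i) (x i)) zi = #|{ffun 'I_n -> key D k}|%:R^-1 *
        \sum_w med (T i) Y k.+1 q' (vR Y (encrypted_profile n k D T x w i)) zi.
      case: Hpi => _ _ /(_ x Hx i) /strategy_ofP [He Ex].
      have EP w : encrypted_profile n k D T x w i =
          pure_vec Y (encrypt D k (T i) (strategy_of (T i) (x i)) (w i)) by rewrite ffunE.
      rewrite [in LHS]Ex -HA // -(ffun_average R n _ _ i); last by apply/card_gt0P; exists 0.
      by congr (_ * _); apply: eq_bigr => w _; rewrite EP.
    rewrite exchange_big mulr_sumr /=; apply: eq_bigr => z _.
    by rewrite HL -mulr_sumr -mulr_suml mulrCA; congr (_ * _); rewrite mulrA.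
  + rewrite lerD2r le_eqVlt; apply/orP; left; apply/eqP; apply: eq_bigr => x _.
    case: (eqVneq (pi x) 0) => [->|Hx]; first by rewrite !mul0r.
    congr (_ * _); rewrite -[LHS](average_const R n k D); congr (_ * _).
    apply: eq_bigr => w _; rewrite /util; apply: eq_bigr => z _; congr (_ * _).
    by apply: eq_bigr => j _; rewrite Hmed.
(* Encryptions of a profile [x'] of positive weight decrypt to [x'], so only those of [x] meet the
   condition. *)
- rewrite big_mkcond /=.
  under [RHS]eq_bigr => y _ do rewrite -mulrb -mulr_natr.
  rewrite encrypted_dist_sum (bigD1 x) //= [X in _ + X]big1 => [|x' Hx'].
  + rewrite addr0; case: (eqVneq (pi x) 0) => [->|Hx]; first by rewrite mul0r.
    rewrite (eq_bigr (fun=> 1)) ?average_const ?mulr1 // => w _.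
    by rewrite (_ : [forall _, _] = true) //; apply/forallP => j; rewrite Hmed.
  + case: (eqVneq (pi x') 0) => [->|Hx]; first by rewrite mul0r.
    rewrite big1 ?mulr0 // => w _; rewrite (_ : [forall _, _] = false) //.
    apply/negbTE; apply: contra Hx' => /forallP H; apply/eqP/ffunP => j.
    by apply: (@vR_inj R _ (T j)); apply/eqP; rewrite -(Hmed x' w).
Qed.
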